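(* Let $\ell, \tau > 0$, let $\kappa > 0$ and assume that $T \in (0, 3/\ell^2)$. There exists a positive constant $\alpha_0$ such that, for any $\alpha \in \mathbb{R}$ satisfying $|\alpha| < \alpha_0$, the beam system given in the context is uniformly exponentially stable. Specifically, for a suitable choice of the constant $\xi>0$ in the energy $E$ defined in the context, there exist positive constants $\zeta_1$ and $\zeta_2$, independent of the initial data, such that for any solution of the beam system $$E(t) \le \zeta_1 E(0) e^{-\zeta_2 t}, \quad \forall t \ge 0.$$
   Context: The beam system is $$y_{tt}(x,t) + y_{xxxx}(x,t) - T y_{xx}(x,t) + \alpha y_t(x,t-\tau) = 0, \quad (x,t) \in (0,\ell)\times(0,+\infty),$$ $$y(0,t) = y_x(0,t) = 0, \quad y_{xx}(\ell,t) = 0, \quad y_{xxx}(\ell,t) - T y_x(\ell,t) = \kappa y_t(\ell,t), \quad t>0,$$ $$y(x,0) = y_0(x), \quad y_t(x,0) = y_1(x), \quad x \in [0,\ell], \qquad y_t(x,s) = f_0(x,s), \quad x \in (0,\ell),\ s \in (-\tau,0).$$ The energy associated with a solution $y$ is $$E(t) := \frac12\left( \int_0^\ell y_t^2(x,t)\,dx + \int_0^\ell y_{xx}^2(x,t)\,dx + T\int_0^\ell y_x^2(x,t)\,dx \right) + \frac{\xi}{2}\int_0^\ell\int_0^1 y_t^2(x,t-s\tau)\,ds\,dx, \quad t \ge 0,$$ where $\xi>0$ is a constant and $y_t$ on $(-\tau,0)$ is given by $f_0$. Solutions are understood as follows. With $u(x,s,t) := y_t(x,t-\tau s)$, $s\in(0,1)$,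 and $v=y_t$, the system is recast as $\frac{dY}{dt}=\mathbb{A}Y$, $Y(0)=Y_0=(y_0,y_1,f_0(\cdot,-\tau s))$, for $Y=(y,v,u)$ in the space $\mathscr{H} := H^2_E(0,\ell)\times L^2(0,\ell)\times L^2((0,\ell)\times(0,1))$, where $H^2_E(0,\ell) := \{ y\in H^2(0,\ell): y(0)=y'(0)=0\}$. Here $\mathscr{D}(\mathbb{A})$ is the set of $(y,v,u)\in\mathscr{H}$ with $y\in H^4(0,\ell)$, $v\in H^2_E(0,\ell)$, $u\in L^2(0,\ell;H^1(0,1))$, $v=u(\cdot,0)$, $y''(\ell)=0$, $y^{(3)}(\ell)-Ty'(\ell)=\kappa v(\ell)$, and $\mathbb{A}(y,v,u) := (v,\,-y^{(4)}+Ty''-\alpha u(\cdot,1),\,-\tau^{-1}u_s)$. The operator $\mathbb{A}$ generates a $C_0$-semigroup on $\mathscr{H}$; the solution for $Y_0\in\mathscr{H}$ is the corresponding mild solution (classical if $Y_0\in\mathscr{D}(\mathbb{A})$), and in $E(t)$ the quantities $y_t(x,t)$ and $y_t(x,t-s\tau)$ are read as the components $v$ and $u(x,s,t)$ of $Y(t)$. *)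

(* Defs.v *)
(* MathComp-Analysis, over an abstract [R : realType]. *)
From mathcomp Require Import all_boot all_order all_algebra.
From mathcomp Require Import all_classical all_reals all_analysis.

Set Implicit Arguments.
Unset Strict Implicit.
Unset Printing Implicit Defensive.

Import Order.TTheory GRing.Theory Num.Theory.
Import numFieldNormedType.Exports.

Local Open Scope classical_set_scope.
Local Open Scope ring_scope.

Notation lebesgue2 R :=
  ((@lebesgue_measure R) \x (@lebesgue_measure R))%E.

Definition square_integrable d (X : measurableType d) (R : realType)
    (mu : {measure set X -> \bar R}) (D : set X) (f : X -> R) : Prop :=
  measurable_fun D f /\ mu.-integrable D (fun x => ((f x) ^+ 2)%:E).

(* On an interval, f is (the continuous representative of an element) of H^n
   iff f, f', ..., f^(n-1) are successive primitives and f^(n) is in L^2.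
   [j k] is the k-th derivative: pointwise determined on [a, b] for k < n,
   determined almost everywhere for k = n. Working on [a, b] rather than
   ]a, b[ gives the traces at the end points as plain values. *)
Definition sobolev_jet (R : realType) (a b : R) (n : nat) (f : R -> R)
    (j : nat -> R -> R) : Prop :=
  [/\ forall x, x \in `[a, b] -> j 0%N x = f x,
      forall k, (k <= n)%N ->
        square_integrable (@lebesgue_measure R) `[a, b] (j k)
    & forall k x, (k < n)%N -> x \in `[a, b] ->
        j k x = j k a
                + \int[@lebesgue_measure R]_(r in `[a, x]) j k.+1 r].

Definition sobolev (R : realType) (a b : R) (n : nat) : set (R -> R) :=
  [set f | exists j, sobolev_jet a b n f j].

(* The k-th derivative (k <= n) of f, for f in H^n(a, b). *)
Definition sobolev_deriv (R : realType) (a b : R) (n : nat) (f : R -> R)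
    (k : nat) : R -> R :=
  xget (fun _ _ => 0) [set j | sobolev_jet a b n f j] k.

Definition H2E (R : realType) (l : R) : set (R -> R) :=
  [set y | sobolev 0 l 2 y /\ y 0 = 0 /\ sobolev_deriv 0 l 2 y 1 0 = 0].

Definition rect (R : realType) (l : R) : set (R * R) :=
  `[0, l] `*` `[0, 1].

(* [w] is the derivative u_s of u(x, s), for u in L^2(0, l; H^1(0, 1)). *)
Definition is_sderiv (R : realType) (l : R) (u w : R * R -> R) : Prop :=
  square_integrable (lebesgue2 R) (rect l) w /\
  {ae @lebesgue_measure R, forall x, x \in `[0, l] ->
     forall s, s \in `[0, 1] ->
       u (x, s) = u (x, 0) + \int[@lebesgue_measure R]_(r in `[0, s]) w (x, r)}.

Definition L2H1 (R : realType) (l : R) : set (R * R -> R) :=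
  [set u | square_integrable (lebesgue2 R) (rect l) u /\
           exists w, is_sderiv l u w].

Definition sderiv (R : realType) (l : R) (u : R * R -> R) : R * R -> R :=
  xget (fun _ => 0) [set w | is_sderiv l u w].

(* Triples (y, v, u); sums and differences are those of the product of
   function spaces. *)
Definition state (R : realType) : Type :=
  ((R -> R) * (R -> R) * (R * R -> R))%type.

Definition pos (R : realType) (Y : state R) : R -> R := Y.1.1.
Definition vel (R : realType) (Y : state R) : R -> R := Y.1.2.
Definition hist (R : realType) (Y : state R) : R * R -> R := Y.2.

Definition inH (R : realType) (l : R) : set (state R) :=
  [set Y | [/\ H2E l (pos Y),
               square_integrable (@lebesgue_measure R) `[0, l] (vel Y)
             & square_integrable (lebesgue2 R) (rect l) (hist Y)]].

(* Equality in H of two representatives. *)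
Definition eqH (R : realType) (l : R) (Y W : state R) : Prop :=
  [/\ forall x, x \in `[0, l] -> pos Y x = pos W x,
      {ae @lebesgue_measure R, forall x, x \in `[0, l] -> vel Y x = vel W x}
    & {ae lebesgue2 R, forall p, rect l p -> hist Y p = hist W p}].

Definition dotH (R : realType) (l : R) (Y W : state R) : R :=
  \sum_(k < 3) \int[@lebesgue_measure R]_(x in `[0, l])
      (sobolev_deriv 0 l 2 (pos Y) k x * sobolev_deriv 0 l 2 (pos W) k x)
  + \int[@lebesgue_measure R]_(x in `[0, l]) (vel Y x * vel W x)
  + \int[lebesgue2 R]_(p in rect l) (hist Y p * hist W p).

Definition normH (R : realType) (l : R) (Y : state R) : R :=
  Num.sqrt (dotH l Y Y).

(* Elements of D(A) are given by the representatives for which the pointwise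
   values in the boundary conditions are meaningful: v is the continuous
   representative and, for a.e. x, u(x, .) is the continuous one. *)
Definition domA (R : realType) (l T kappa : R) : set (state R) :=
  [set Y | let y := pos Y in let v := vel Y in let u := hist Y in
    [/\ inH l Y, sobolev 0 l 4 y, H2E l v, L2H1 l u &
    [/\ {ae @lebesgue_measure R, forall x, x \in `[0, l] -> v x = u (x, 0)},
        sobolev_deriv 0 l 4 y 2 l = 0
      & sobolev_deriv 0 l 4 y 3 l - T * sobolev_deriv 0 l 4 y 1 l
        = kappa * v l]]].

Definition opA (R : realType) (l tau T alpha : R) (Y : state R) : state R :=
  let y := pos Y in let v := vel Y in let u := hist Y in
  (v,
   fun x => - sobolev_deriv 0 l 4 y 4 x + T * sobolev_deriv 0 l 4 y 2 x
            - alpha * u (x, 1),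
   fun p => - tau^-1 * sderiv l u p).

(* Z = \int_0^t Y(s) ds in the Hilbert space H, for continuous Y: the vector
   integral is tested against the elements of H. *)
Definition is_integralH (R : realType) (l t : R) (Y : R -> state R)
    (Z : state R) : Prop :=
  inH l Z /\
  forall W, inH l W ->
    dotH l Z W = \int[@lebesgue_measure R]_(s in `[0, t]) dotH l (Y s) W.

Definition continuousH (R : realType) (l : R) (Y : R -> state R) : Prop :=
  (forall t : R, 0 <= t -> inH l (Y t)) /\
  forall t : R, 0 <= t ->
    normH l (Y s - Y t) @[s --> within [set s : R | 0 <= s] (nbhs t)] --> (0 : R).

(* Mild solution of dY/dt = A Y, Y(0) = Y0: Y is continuous into H,
   \int_0^t Y lies in D(A) and Y(t) = Y0 + A \int_0^t Y for all t >= 0. *)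
Definition mild_solution (R : realType) (l tau kappa T alpha : R)
    (Y0 : state R) (Y : R -> state R) : Prop :=
  continuousH l Y /\
  forall t : R, 0 <= t -> exists Z,
    [/\ is_integralH l t Y Z, domA l T kappa Z
      & eqH l (Y t) (Y0 + opA l tau T alpha Z)].

Definition initial_state (R : realType) (tau : R) (y0 y1 : R -> R)
    (f0 : R -> R -> R) : state R :=
  (y0, y1, fun p : R * R => f0 p.1 (- tau * p.2)).

Definition beam_solution (R : realType) (l tau kappa T alpha : R)
    (y0 y1 : R -> R) (f0 : R -> R -> R) (Y : R -> state R) : Prop :=
  inH l (initial_state tau y0 y1 f0) /\
  mild_solution l tau kappa T alpha (initial_state tau y0 y1 f0) Y.

(* y_t(x, t) is [vel (Y t)] and y_t(x, t - s tau) is [hist (Y t) (x, s)]. *)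
Definition energy (R : realType) (l T xi : R) (Y : R -> state R) (t : R) : R :=
  2^-1 * (\int[@lebesgue_measure R]_(x in `[0, l]) (vel (Y t) x) ^+ 2
          + \int[@lebesgue_measure R]_(x in `[0, l])
              (sobolev_deriv 0 l 2 (pos (Y t)) 2 x) ^+ 2
          + T * \int[@lebesgue_measure R]_(x in `[0, l])
              (sobolev_deriv 0 l 2 (pos (Y t)) 1 x) ^+ 2)
  + xi / 2 * \int[lebesgue2 R]_(p in rect l) (hist (Y t) p) ^+ 2.

(* Main.v *)
(* For a mild solution Y with integral Z, the increments D(t) = Z(t + h) - Z(t) lie
   in D(A) and satisfy D' = A D whatever the regularity of Y, and D(t) / h tends to
   Y(t) as h tends to 0. It is therefore enough to find a bounded symmetric form
   L on H, equivalent to the energy, with 2 L(D, A D) <= - c L(D, D) on D(A). With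
   xi = eps tau / 8,
     L(Y, Y) = |v|^2 + |y''|^2 + T |y'|^2 + xi |(2 - s)^(1/2) u|^2 + 2 eps <x y', v>
   has this property for small eps: the multiplier x y' yields
   - |v|^2 / 2 - T |y'|^2 / 2 - 3 |y''|^2 / 2 and the boundary term - l T y'(l)^2 / 2,
   which together with the boundary damping - kappa v(l)^2 absorbs the other boundary
   terms; the history yields - xi / (2 tau) |u(., 1)|^2, which absorbs the delayed
   term when alpha is small. *)
Require Import Defs.
From mathcomp Require Import all_boot all_order all_algebra.
From mathcomp Require Import all_classical all_reals all_analysis.
From mathcomp Require Import measurable_realfun ring lra.
Set Implicit Arguments.
Unset Strict Implicit.
Unset Printing Implicit Defensive.
Import Order.TTheory GRing.Theory Num.Theory.
Import numFieldNormedType.Exports.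
Local Open Scope classical_set_scope.
Local Open Scope ring_scope.

(** * Semigroup-free decay for a quadratic form *)

(** The values [Y t] need not lie in D(A), and the mild equation carries the initial state.
    Differences between two times cancel that state, so [Y b - Y a] is A applied to [Z b - Z a];
    this is the only form in which the equation enters. The integral defining [Z] is weak, so its
    differentiability in norm has to be recovered from the continuity of [Y]. A second obstacle is
    that derivatives of states are arbitrary choices, and those of top order are linear in the state
    only almost everywhere; they are therefore used only under integrals. Constants: the cross term
    of L is at most eps l (|v|^2 + |y'|^2), so eps l <= 1/2 and eps l <= T/2 keep L between E and 4
    E, whence the factor 4 in the decay. With xi = eps tau / 8 the history contributes - eps / 16
    (|u(., 1)|^2 + |u|^2 - 2 |v|^2) to L(D, A D): it spends eps / 8 of the eps / 2 that the
    multiplier supplies on |v|^2, and its |u(., 1)|^2 part fixes the bound eps / 12 on |alpha|. *)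

Section PsdForms.
Variables (R : realType) (V : lmodType R) (H : set V).

Definition lin_closed := forall (r : R) x y, H x -> H y -> H (r *: x + y).

Definition sym_bilinear (B : V -> V -> R) :=
  (forall x y, H x -> H y -> B x y = B y x) /\
  forall r x y z, H x -> H y -> H z -> B (r *: x + y) z = r * B x z + B y z.

(** Semidefinite only, since states are functions and not classes modulo null sets; restricted to
    [H], since the integrals behave bilinearly only on square-integrable data. *)
Definition psd_form (B : V -> V -> R) :=
  sym_bilinear B /\ forall x, H x -> 0 <= B x x.

Lemma sym_bilinearD (B C : V -> V -> R) : sym_bilinear B -> sym_bilinear C ->
  sym_bilinear (fun x y => B x y + C x y).
Proof.
move=> [Bs Bl] [Cs Cl]; split=> [x y Hx Hy|r x y z Hx Hy Hz]; first by rewrite Bs// Cs.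
by rewrite Bl// Cl//; ring.
Qed.

Lemma sym_bilinearZ (k : R) (B : V -> V -> R) : sym_bilinear B ->
  sym_bilinear (fun x y => k * B x y).
Proof.
move=> [Bs Bl]; split=> [x y Hx Hy|r x y z Hx Hy Hz]; first by rewrite Bs.
by rewrite Bl//; ring.
Qed.

Definition seminorm (B : V -> V -> R) x := Num.sqrt (B x x).

Hypothesis Hlin : lin_closed.

Lemma lin_closed0 x : H x -> H 0.
Proof. by move=> Hx; rewrite -(addNr x) -scaleN1r; exact: Hlin. Qed.

Lemma lin_closedZ (r : R) x : H x -> H (r *: x).
Proof. by move=> Hx; rewrite -[r *: x]addr0; apply: Hlin => //; exact: lin_closed0 Hx. Qed.

Lemma lin_closedD x y : H x -> H y -> H (x + y).
Proof. by move=> Hx Hy; rewrite -[x]scale1r; exact: Hlin. Qed.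

Lemma lin_closedB x y : H x -> H y -> H (x - y).
Proof. by move=> Hx Hy; rewrite addrC -scaleN1r; exact: Hlin. Qed.

Variable B : V -> V -> R.
Hypothesis BP : psd_form B.

Lemma psd_formC x y : H x -> H y -> B x y = B y x.
Proof. by case: BP => -[+ _] _; apply. Qed.

Lemma psd_form_ge0 x : H x -> 0 <= B x x.
Proof. by case: BP => _; apply. Qed.

Lemma psd_formDl x y z : H x -> H y -> H z -> B (x + y) z = B x z + B y z.
Proof.
by case: BP => -[_ BL] _ Hx Hy Hz; rewrite -{1}[x]scale1r BL// mul1r.
Qed.

Lemma psd_formZl r x z : H x -> H z -> B (r *: x) z = r * B x z.
Proof.
case: BP => -[_ BL] _ Hx Hz; have H0 := lin_closed0 Hx.
have B0 : B 0 z = 0.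
  by have := psd_formDl H0 H0 Hz; rewrite addr0 => /eqP; rewrite -subr_eq0 opprD addNKr oppr_eq0 =>
    /eqP.
by rewrite -[r *: x]addr0 BL// B0 addr0.
Qed.

Lemma psd_formBl x y z : H x -> H y -> H z -> B (x - y) z = B x z - B y z.
Proof.
move=> Hx Hy Hz; rewrite psd_formDl//; last by rewrite -scaleN1r; exact: lin_closedZ.
by rewrite -scaleN1r psd_formZl// mulN1r.
Qed.

Lemma psd_formZr r x z : H x -> H z -> B x (r *: z) = r * B x z.
Proof.
by move=> Hx Hz; rewrite psd_formC ?psd_formZl//; [rewrite (psd_formC Hx)|exact: lin_closedZ].
Qed.

Lemma psd_formDr x y z : H x -> H y -> H z -> B x (y + z) = B x y + B x z.
Proof.
move=> Hx Hy Hz; rewrite psd_formC//; last exact: lin_closedD.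
by rewrite psd_formDl// (psd_formC Hx Hy) (psd_formC Hx Hz).
Qed.

Lemma seminorm_ge0 x : 0 <= seminorm B x.
Proof. exact: sqrtr_ge0. Qed.

Lemma seminorm_sqr x : H x -> seminorm B x ^+ 2 = B x x.
Proof. by move=> Hx; rewrite sqr_sqrtr// psd_form_ge0. Qed.

Lemma cauchy_schwarz x y : H x -> H y -> `|B x y| <= seminorm B x * seminorm B y.
Proof.
move=> Hx Hy.
have Q t : 0 <= t ^+ 2 * B x x + 2 * t * B x y + B y y.
  have Htx := lin_closedZ t Hx.
  have := psd_form_ge0 (lin_closedD Htx Hy).
  rewrite psd_formDl// ?psd_formDr//; last exact: lin_closedD.
  rewrite !psd_formZl// !psd_formZr// (psd_formC Hy Hx).
  by move=> /le_trans; apply; rewrite le_eqVlt; apply/orP; left; apply/eqP; ring.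
have Bx := psd_form_ge0 Hx.
rewrite -sqrtrM// -sqrtr_sqr; apply: ler_wsqrtr.
move: Bx; rewrite le_eqVlt => /predU1P[Bx0|Bx0].
  rewrite -Bx0 mul0r.
  have [->|Bxy] := eqVneq (B x y) 0; first by rewrite expr0n.
  (* When [B x x = 0] the polynomial [Q] is affine in [t], and at this point it equals -1. *)
  have := Q (- (B y y + 1) / (2 * B x y)).
  rewrite -Bx0 mulr0 add0r.
  rewrite (_ : _ + _ = -1); last by field.
  by rewrite oppr_ge0 ler10.
have := Q (- B x y / B x x).
rewrite (_ : _ + _ = (B x x * B y y - B x y ^+ 2) / B x x); last by field; rewrite gt_eqF.
by rewrite pmulr_lge0 ?invr_gt0// subr_ge0.
Qed.

Lemma seminormD x y : H x -> H y -> seminorm B (x + y) <= seminorm B x + seminorm B y.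
Proof.
move=> Hx Hy; have Hxy := lin_closedD Hx Hy.
rewrite -(@ler_pXn2r _ 2)// ?nnegrE ?addr_ge0 ?seminorm_ge0//.
rewrite seminorm_sqr// psd_formDl// !psd_formDr// (psd_formC Hy Hx).
rewrite sqrrD !seminorm_sqr//.
have := le_trans (ler_norm _) (cauchy_schwarz Hx Hy).
by rewrite mulr2n; lra.
Qed.

Lemma seminormZ r x : H x -> seminorm B (r *: x) = `|r| * seminorm B x.
Proof.
move=> Hx; rewrite /seminorm psd_formZl//; last exact: lin_closedZ.
by rewrite psd_formZr// mulrA -expr2 sqrtrM ?sqr_ge0// sqrtr_sqr.
Qed.

Lemma seminormBC x y : H x -> H y -> seminorm B (x - y) = seminorm B (y - x).
Proof.
move=> Hx Hy; rewrite -(opprB y) -[- (y - x)]scaleN1r seminormZ; last exact: lin_closedB.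
by rewrite normrN1 mul1r.
Qed.

(** For an increment [d] with linear part [r *: g], this isolates the error in the derivative of a
    quadratic form: it is o(r) as soon as [rho] is. *)
Lemma psd_form_expand r x d rho g : H x -> H d -> H rho -> H g -> d = rho + r *: g ->
  B (x + d) (x + d) - B x x - r * (2 * B x g) = 2 * B x rho + B d d.
Proof.
move=> Hx Hd Hrho Hg dE.
have Bxd : B x d = B x rho + r * B x g.
  by rewrite dE psd_formDr ?psd_formZr//; exact: lin_closedZ.
rewrite psd_formDl ?psd_formDr// ?(psd_formC Hd Hx) ?Bxd; last exact: lin_closedD.
by ring.
Qed.

End PsdForms.

(** * Differentiability on the closed half-line and Gronwall's inequality *)

Section Gronwall.
Variable R : realType.

(** Both points range over the closed half-line, so the derivative at 0 is one-sided and nothing is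
    asked at negative times. *)
Definition derives_from0 (g g' : R -> R) := forall t : R, 0 <= t -> forall e : R, 0 < e ->
  exists2 d : R, 0 < d & forall s : R, 0 <= s -> `|s - t| < d ->
    `|g s - g t - (s - t) * g' t| <= `|s - t| * e.

Lemma derives_from0_is_derive (g g' : R -> R) (t : R) : derives_from0 g g' -> 0 < t -> is_derive t
  1 g (g' t).
Proof.
move=> gg' t0; apply/is_derive1_caratheodory.
exists (fun z => if z == t then g' t else (g z - g t) / (z - t)); split.
- move=> z; case: eqVneq => [->|zt]; first by rewrite !subrr mulr0.
  by rewrite divfK// subr_eq0.
- rewrite /prop_for/= /continuous_at/= eqxx; apply/cvgrPdist_le => /= e e0.
  have [d d0 gd] := gg' t (ltW t0) _ e0.
  near=> z; case: eqVneq => [_|zt]; first by rewrite subrr normr0 ltW.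
  have zt0 : z - t != 0 by rewrite subr_eq0.
  rewrite distrC (_ : _ - _ = (g z - g t - (z - t) * g' t) / (z - t)); last by field.
  rewrite normrM normfV ler_pdivrMr ?normr_gt0// [leRHS]mulrC; apply: gd.
    by apply/ltW; near: z; apply: (cvgr_gt t) => //; exact: cvg_id.
  by rewrite distrC; near: z; apply: cvgr_dist_lt => //; exact: cvg_id.
- by rewrite eqxx.
Unshelve. all: by end_near. Qed.

(** The product of [g] with exp(c s) has derivative exp(c s) (g' + c g) <= 0 inside the interval and
    is continuous up to its end points, hence does not increase. *)
Lemma gronwall_from0 (c : R) (g g' : R -> R) : derives_from0 g g' -> (forall t : R, 0 <= t -> g' t
  <= - c * g t) ->
  forall t : R, 0 <= t -> g t <= g 0 * expR (- c * t).
Proof.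
move=> gg' g'c t t0.
pose f s := g s * expR (c * s).
have dexp (s : R) : is_derive s 1 (fun s : R => expR (c * s)) (c * expR (c * s)).
  have d1 : is_derive s (1 : R) (fun s : R => c *: (s : R^o)) (c *: 1).
    exact: is_deriveZ.
  have := is_derive1_comp (is_derive_expR (c * s)) d1.
  by rewrite /GRing.scale/= mulr1 mulrC.
have df (s : R) : 0 < s -> is_derive s 1 f (g s * (c * expR (c * s)) + expR (c * s) * g' s).
  move=> s0; have := derives_from0_is_derive gg' s0 => ?.
  exact: is_deriveM.
suff : f t <= f 0.
  rewrite /f mulr0 expR0 mulr1 => ft.
  by rewrite mulNr expRN ler_pdivlMr// expR_gt0.
apply: (@ler0_derive1_nincr _ f 0 t) => //.
- by move=> s; rewrite in_itv/= => /andP[s0 _]; have [] := df s s0.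
- move=> s; rewrite in_itv/= => /andP[s0 _]; rewrite derive1E; have [_ ->] := df s s0.
  rewrite (_ : _ + _ = - (expR (c * s) * (- c * g s - g' s))); last by ring.
  by rewrite oppr_le0 mulr_ge0 ?expR_ge0// subr_ge0 g'c// ltW.
- apply/subspace_continuousP => s /=; rewrite in_itv/= => /andP[s0 _].
  (* The expansion with error 1 gives the Lipschitz estimate |g x - g s| <= |x - s| (1 + |g' s|)
     near [s], also at the end point 0. *)
  have cg : g x @[x --> within `[0, t] (nbhs s)] --> g s.
    apply/cvgrPdist_le => /= e e0.
    have [d d0 gd] := gg' s s0 1 ltr01.
    pose K := 1 + `|g' s|.
    have K0 : 0 < K by rewrite ltr_pwDl.
    have eK0 : 0 < e / K by rewrite divr_gt0.
    rewrite near_withinE; near=> x => /=; rewrite in_itv/= => /andP[x0 _].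
    have xs1 : `|x - s| < d.
      by rewrite distrC; near: x; apply: cvgr_dist_lt => //; exact: cvg_id.
    have xs2 : `|x - s| < e / K.
      by rewrite distrC; near: x; apply: cvgr_dist_lt => //; exact: cvg_id.
    have h := gd x x0 xs1.
    rewrite distrC (_ : g x - g s = (g x - g s - (x - s) * g' s) + (x - s) * g' s); last by ring.
    rewrite (le_trans (ler_normD _ _))// normrM.
    apply: (@le_trans _ _ (`|x - s| * K)); first by rewrite /K mulrDr lerD2r.
    by rewrite -ler_pdivlMr// ltW.
  apply: cvgM => //.
  apply: cvg_within_filter; have [/derivable1_diffP/differentiable_continuous + _] := dexp s.
  exact.
Unshelve. all: by end_near. Qed.

End Gronwall.

(** * Norm differentiability of a weakly defined integral, and decay along it *)

Section WeakIntegral.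
Variables (R : realType) (V : lmodType R) (H : set V) (dot : V -> V -> R).
Hypotheses (Hlin : lin_closed H) (dotP : psd_form H dot).
Variables (Y Z : R -> V).
Notation mu := (@lebesgue_measure R).
Notation nrm := (seminorm dot).
Hypothesis HY : forall t : R, 0 <= t -> H (Y t).
Hypothesis cY : forall t : R, 0 <= t ->
  nrm (Y s - Y t) @[s --> within [set s : R | 0 <= s] (nbhs t)] --> (0 : R).
Hypothesis HZ : forall t : R, 0 <= t -> H (Z t).
Hypothesis intZ : forall t : R, 0 <= t -> forall W, H W ->
  dot (Z t) W = \int[mu]_(s in `[0, t]) dot (Y s) W.

Lemma continuous_from0 (t e : R) : 0 <= t -> 0 < e ->
  exists2 d : R, 0 < d & forall s : R, 0 <= s -> `|s - t| < d -> nrm (Y s - Y t) < e.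
Proof.
move=> t0 e0; have /cvgrPdist_lt /(_ _ e0) := cY t0.
rewrite near_withinE => /nbhs_ballP[d /= d0 dY]; exists d => // s s0 st.
have := dY s; rewrite /ball/= distrC => /(_ st s0).
by rewrite sub0r normrN ger0_norm// seminorm_ge0.
Qed.

Lemma dot_integrable (b : R) W : 0 <= b -> H W ->
  mu.-integrable `[0, b] (EFin \o (fun s => dot (Y s) W)).
Proof.
move=> b0 HW; apply: continuous_compact_integrable; first exact: segment_compact.
apply/subspace_continuousP => t /=; rewrite in_itv/= => /andP[t0 _].
apply/cvgrPdist_lt => /= e e0.
have K0 : 0 < nrm W + 1 by rewrite ltr_wpDl ?seminorm_ge0.
have [d d0 dY] := continuous_from0 t0 (divr_gt0 e0 K0).
rewrite near_withinE; near=> s => /=; rewrite in_itv/= => /andP[s0 _].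
have st : `|s - t| < d.
  by rewrite distrC; near: s; apply: cvgr_dist_lt => //; exact: cvg_id.
have [HYs HYt] := (HY s0, HY t0).
rewrite distrC -(psd_formBl Hlin dotP)//.
apply: le_lt_trans (cauchy_schwarz Hlin dotP (lin_closedB Hlin HYs HYt) HW) _.
have := dY s s0 st; rewrite ltr_pdivlMr// => /(le_lt_trans _); apply.
by rewrite ler_wpM2l ?seminorm_ge0// lerDl.
Unshelve. all: by end_near. Qed.

(** The weak identity is tested against the remainder [W] itself: |W|^2 is the integral of <Y s - y,
    W>, at most (b - a) eta |W| by Cauchy-Schwarz, and one factor |W| is divided out. *)
Lemma weak_integral_bound (a b eta : R) y : 0 <= a -> a <= b -> H y ->
  (forall s, a <= s <= b -> nrm (Y s - y) <= eta) ->
  nrm (Z b - Z a - (b - a) *: y) <= (b - a) * eta.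
Proof.
move=> a0 ab Hy Yy; have b0 := le_trans a0 ab.
have eta0 : 0 <= eta by apply: le_trans (Yy a _); rewrite ?seminorm_ge0 ?lexx.
have [HZa HZb] := (HZ a0, HZ b0).
have Hby := lin_closedZ Hlin (b - a) Hy.
have HZba := lin_closedB Hlin HZb HZa.
set W := _ - _; have HW : H W by exact: lin_closedB.
have iY := dot_integrable b0 HW.
have iYab : mu.-integrable `]a, b] (EFin \o (fun s => dot (Y s) W)).
  by apply: integrableS iY => //; apply: subset_itv; rewrite bnd_simp.
have icst r : mu.-integrable `]a, b] (EFin \o (fun=> r : R)).
  apply: integrableS (continuous_compact_integrable (@segment_compact _ a b) _) => //.
    exact: subset_itv_oc_cc.
  exact/continuous_subspaceT/cst_continuous.
have muab : fine (mu `]a, b]%classic) = b - a.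
  by rewrite lebesgue_measure_itv/= lte_fin; case: ltgtP ab => // -> _; rewrite subrr.
have WE : dot W W = \int[mu]_(s in `]a, b]) (dot (Y s) W - dot y W).
  rewrite {1}/W (psd_formBl Hlin dotP)// (psd_formBl Hlin dotP)//.
  rewrite (psd_formZl Hlin dotP)// !intZ// Rintegral_itvB ?bnd_simp//.
  by rewrite RintegralB// Rintegral_cst// muab mulrC.
have WW : nrm W ^+ 2 <= (b - a) * eta * nrm W.
  rewrite (seminorm_sqr dotP)// WE; apply: (@le_trans _ _ (\int[mu]_(s in `]a, b]) (eta * nrm W))).
    apply: le_Rintegral => //.
      have := integrableB _ iYab (icst (dot y W)); exact.
    move=> s /=; rewrite in_itv/= => /andP[/ltW sa sb].
    have s0 := le_trans a0 sa; have HYs := HY s0.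
    rewrite -(psd_formBl Hlin dotP)//.
    have HYsy := lin_closedB Hlin HYs Hy.
    apply: le_trans (ler_norm _) _; apply: le_trans (cauchy_schwarz Hlin dotP HYsy HW) _.
    by rewrite ler_wpM2r ?seminorm_ge0// Yy// sa.
  by rewrite Rintegral_cst// muab mulrC mulrA.
have [->|W0] := eqVneq (nrm W) 0; first by rewrite mulr_ge0// subr_ge0.
have Wp : 0 < nrm W by rewrite lt_neqAle eq_sym W0 seminorm_ge0.
by rewrite -(ler_pM2r Wp) -expr2.
Qed.

(** Continuity of [Y] makes [eta] small on a short interval, so [Z] has derivative [Y] in norm
    although it is only defined by testing. Points on the left of [t] are handled by exchanging the
    roles of [s] and [t]. *)
Lemma weak_integral_expansion (t e : R) : 0 <= t -> 0 < e ->
  exists2 d : R, 0 < d & forall s : R, 0 <= s -> `|s - t| < d ->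
    nrm (Z s - Z t - (s - t) *: Y t) <= `|s - t| * e.
Proof.
move=> t0 e0; have [d d0 dY] := continuous_from0 t0 e0; exists d => // s s0 st.
have [HZs HZt HYt] := And3 (HZ s0) (HZ t0) (HY t0).
have [ts|/ltW ts] := leP t s.
  rewrite ger0_norm ?subr_ge0//; apply: weak_integral_bound => // r /andP[tr rs].
  apply/ltW/dY; first exact: le_trans tr.
  by move: st; rewrite !ger0_norm ?subr_ge0//; apply: le_lt_trans; rewrite lerD2r.
rewrite (_ : _ - _ = - (Z t - Z s - (t - s) *: Y t)); last first.
  by rewrite opprB opprB !scalerBl opprB addrC addrC.
rewrite -scaleN1r (seminormZ Hlin dotP); last first.
  by apply: lin_closedB => //; [exact: lin_closedB|exact: lin_closedZ].
rewrite normrN1 mul1r distrC ger0_norm ?subr_ge0//.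
apply: weak_integral_bound => // r /andP[sr rt].
apply/ltW/dY; first exact: le_trans sr.
move: st; rewrite distrC (distrC r) !ger0_norm ?subr_ge0//.
by apply: le_lt_trans; rewrite lerB.
Qed.

(** [dot] carries the topology and [B] the decay. An upper bound of [B] by [dot] suffices to
    transfer convergence; [Bdiss] is dissipativity, with [Y b - Y a] in the role of A applied to
    [Z b - Z a]. *)
Variables (B : V -> V -> R) (C c : R).
Hypotheses (BP : psd_form H B) (C0 : 0 < C) (c0 : 0 < c).
Hypothesis BC : forall x, H x -> B x x <= C ^+ 2 * dot x x.
Hypothesis Bdiss : forall a b : R, 0 <= a -> 0 <= b ->
  2 * B (Z b - Z a) (Y b - Y a) <= - c * B (Z b - Z a) (Z b - Z a).
Notation beta := (seminorm B).

Lemma seminorm_le x : H x -> beta x <= C * nrm x.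
Proof.
move=> Hx; have Cn : 0 <= C * nrm x by rewrite mulr_ge0 ?seminorm_ge0// ltW.
rewrite -(@ler_pXn2r _ 2)// ?nnegrE ?seminorm_ge0//.
by rewrite exprMn (seminorm_sqr BP)// (seminorm_sqr dotP)//; exact: BC.
Qed.

(* [(Z (t + h) - Z t) / h] is a classical solution, whatever the regularity of [Y]. *)
Lemma increment_decay (h t : R) : 0 < h -> 0 <= t ->
  beta (Z (t + h) - Z t) <= beta (Z h - Z 0) * expR (- (c / 2) * t).
Proof.
move=> h0 t0.
pose D s := Z (s + h) - Z s; pose G s := Y (s + h) - Y s.
have sh (s : R) : 0 <= s -> 0 <= s + h by move=> s0; rewrite addr_ge0// ltW.
have HD (s : R) : 0 <= s -> H (D s) by move=> s0; apply: lin_closedB => //; apply: HZ => //; exact: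
  sh.
have HG (s : R) : 0 <= s -> H (G s) by move=> s0; apply: lin_closedB => //; apply: HY => //; exact:
  sh.
have Dexp (s e : R) : 0 <= s -> 0 < e -> exists2 d : R, 0 < d & forall r : R, 0 <= r -> `|r - s| <
  d ->
    beta (D r - D s - (r - s) *: G s) <= `|r - s| * e.
  move=> s0 e0; have e2 : 0 < e / (2 * C) by rewrite divr_gt0// mulr_gt0.
  (* [D] is a difference of two values of [Z]; each gets half of the error, divided by the constant
     [C] that converts [nrm] into [beta]. *)
  have [d1 d10 h1] := weak_integral_expansion s0 e2.
  have [d2 d20 h2] := weak_integral_expansion (sh s s0) e2.
  exists (Num.min d1 d2); first by rewrite lt_min d10.
  move=> r r0; rewrite lt_min => /andP[rd1 rd2].
  have {}h1 := h1 r r0 rd1.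
  have := h2 (r + h) (sh r r0); rewrite (_ : r + h - (s + h) = r - s); last by ring.
  move=> /(_ rd2) {}h2.
  rewrite (_ : _ - _ = (Z (r + h) - Z (s + h) - (r - s) *: Y (s + h)) +
    (- 1) *: (Z r - Z s - (r - s) *: Y s)); last first.
    rewrite /D /G scaleN1r scalerBr !opprD !opprK.
    by rewrite (addrACA (Z (r + h))) (addrACA (Z (r + h) - _)).
  have Ha : H (Z (r + h) - Z (s + h) - (r - s) *: Y (s + h)).
    apply: lin_closedB => //; first by apply: lin_closedB => //; apply: HZ; exact: sh.
    by apply: lin_closedZ => //; apply: HY; exact: sh.
  have Hb : H (Z r - Z s - (r - s) *: Y s).
    apply: lin_closedB => //; first by apply: lin_closedB => //; exact: HZ.
    by apply: lin_closedZ => //; exact: HY.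
  have Hb' := lin_closedZ Hlin (-1) Hb.
  apply: le_trans (seminormD Hlin BP Ha Hb') _.
  rewrite (seminormZ Hlin BP)// normrN1 mul1r.
  apply: (@le_trans _ _ (C * (`|r - s| * (e / (2 * C))) + C * (`|r - s| * (e / (2 * C))))).
    by apply: lerD; apply: le_trans (seminorm_le _) _ => //; rewrite ler_pM2l.
  by rewrite le_eqVlt; apply/orP; left; apply/eqP; field; rewrite gt_eqF.
have gg' : derives_from0 (fun s => B (D s) (D s)) (fun s => 2 * B (D s) (G s)).
  move=> s s0 e e0.
  have [bD bG] := (seminorm_ge0 B (D s), seminorm_ge0 B (G s)).
  (* The error in the derivative is 2 B(D s, rho) + B(del, del). The second entry of the minimum
     bounds the first summand by e / 2 per unit of |r - s|. The entry 1 gives beta del <= |r - s|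
     (beta (G s) + 1), so the extra restriction on |r - s| bounds the second summand by the other
     half. The added 1's avoid dividing by zero. *)
  pose e1 := Num.min 1 (e / (4 * (beta (D s) + 1))).
  have e1p : 0 < e1 by rewrite lt_min ltr01 divr_gt0// mulr_gt0// ltr_wpDl.
  have [d d0 hd] := Dexp s e1 s0 e1p.
  have dp : 0 < e / (2 * (beta (G s) + 1) ^+ 2) by rewrite divr_gt0// mulr_gt0// exprn_gt0//
    ltr_wpDl.
  exists (Num.min d (e / (2 * (beta (G s) + 1) ^+ 2))); first by rewrite lt_min d0.
  move=> r r0; rewrite lt_min => /andP[rd1 rd2].
  have {}hd := hd r r0 rd1.
  have [HDs HDr HGs] := And3 (HD s s0) (HD r r0) (HG s s0).
  set rho := D r - D s - _ in hd.
  have HrG := lin_closedZ Hlin (r - s) HGs.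
  have HDel : H (D r - D s) by exact: lin_closedB.
  have Hrho : H rho by exact: lin_closedB.
  have DelE : D r - D s = rho + (r - s) *: G s by rewrite /rho subrK.
  have DrE : D r = D s + (D r - D s) by rewrite addrC subrK.
  set del := D r - D s in HDel DelE DrE *.
  have -> : B (D r) (D r) - B (D s) (D s) - (r - s) * (2 * B (D s) (G s)) =
     2 * B (D s) rho + B del del.
    by rewrite DrE; exact: (psd_form_expand Hlin BP).
  have b1 := cauchy_schwarz Hlin BP HDs Hrho.
  have b2 : beta del <= `|r - s| * (beta (G s) + 1).
    rewrite DelE; apply: le_trans (seminormD Hlin BP Hrho HrG) _.
    rewrite (seminormZ Hlin BP)// mulrDr mulr1 addrC lerD2l; apply: le_trans hd _.
    by rewrite -[leRHS]mulr1 ler_wpM2l// /e1 ge_min lexx.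
  have b3 : beta (D s) * e1 <= e / 4.
    apply: (@le_trans _ _ ((beta (D s) + 1) * e1)); first by rewrite ler_pM2r// lerDl.
    rewrite mulrC -ler_pdivlMr ?ltr_wpDl// ge_min; apply/orP; right.
    by rewrite le_eqVlt; apply/orP; left; apply/eqP; field; rewrite gt_eqF// ltr_wpDl.
  apply: le_trans (ler_normD _ _) _.
  rewrite [X in _ + X]ger0_norm ?(psd_form_ge0 BP)// -(seminorm_sqr BP)// normrM ger0_norm//.
  have rs0 := normr_ge0 (r - s).
  have b4 : beta del ^+ 2 <= `|r - s| * (e / 2).
    apply: (@le_trans _ _ ((`|r - s| * (beta (G s) + 1)) ^+ 2)).
      by rewrite ler_pXn2r// ?nnegrE ?seminorm_ge0// mulr_ge0// addr_ge0.
    rewrite exprMn expr2 -mulrA ler_wpM2l//.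
    rewrite -ler_pdivlMr; last by rewrite exprn_gt0// ltr_wpDl.
    apply/ltW; apply: lt_le_trans rd2 _.
    rewrite le_eqVlt; apply/orP; left; apply/eqP; field.
    by rewrite gt_eqF// ltr_wpDl.
  have b5 : beta (D s) * beta rho <= `|r - s| * (e / 4).
    apply: le_trans (ler_wpM2l bD hd) _.
    by rewrite mulrCA ler_wpM2l.
  lra.
have diss (s : R) : 0 <= s -> 2 * B (D s) (G s) <= - c * B (D s) (D s).
  by move=> s0; apply: Bdiss => //; exact: sh.
have := gronwall_from0 gg' diss t0.
have [HD0 HDt] := (HD 0 (lexx 0), HD t t0).
rewrite -!(seminorm_sqr BP)// => le2.
have e2 : expR (- c * t) = expR (- (c / 2) * t) ^+ 2.
  by rewrite expr2 -expRD; congr expR; field.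
move: le2; rewrite e2 -exprMn ler_pXn2r// ?nnegrE ?mulr_ge0 ?seminorm_ge0 ?expR_ge0//.
by rewrite /D add0r.
Qed.

(** Divided by [h], the increments over [t, t + h] and [0, h] approximate [Y t] and [Y 0], so the
    decay of increments passes to [Y] as [h] shrinks. *)
Theorem seminorm_decay (t : R) : 0 <= t ->
  B (Y t) (Y t) <= B (Y 0) (Y 0) * expR (- c * t).
Proof.
move=> t0.
have HYt := HY t0; have HY0 := HY (lexx 0).
have et1 : expR (- (c / 2) * t) <= 1.
  by rewrite expR_le1 mulNr oppr_le0 mulr_ge0// divr_ge0// ltW.
suff le1 : beta (Y t) <= beta (Y 0) * expR (- (c / 2) * t).
  rewrite -!(seminorm_sqr BP)//.
  have -> : expR (- c * t) = expR (- (c / 2) * t) ^+ 2.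
    by rewrite expr2 -expRD; congr expR; field.
  by rewrite -exprMn ler_pXn2r// ?nnegrE ?mulr_ge0 ?seminorm_ge0 ?expR_ge0.
apply/ler_addgt0Pr => e e0.
have e2 : 0 < e / (2 * C) by rewrite divr_gt0// mulr_gt0.
have [d1 d10 h1] := weak_integral_expansion t0 e2.
have [d2 d20 h2] := weak_integral_expansion (lexx 0) e2.
pose h : R := Num.min d1 d2 / 2.
have d12 : 0 < Num.min d1 d2 by rewrite lt_min d10.
have hp : 0 < h by rewrite divr_gt0.
have : h < Num.min d1 d2 by rewrite /h ltr_pdivrMr// ltr_pMr// ltr1n.
rewrite lt_min => /andP[hd1 hd2].
have th0 : 0 <= t + h by rewrite addr_ge0// ltW.
have := h1 (t + h) th0; rewrite addrAC subrr add0r gtr0_norm// => /(_ hd1) {}h1.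
have := h2 h (ltW hp); rewrite subr0 gtr0_norm// => /(_ hd2) {}h2.
(* Applied at [s = t] and [s = 0]. Each use costs h e / 2, and the exponential factor, at most 1,
   does not enlarge the second error; the total is h e. *)
have key (s : R) : 0 <= s -> nrm (Z (s + h) - Z s - h *: Y s) <= h * (e / (2 * C)) ->
    `|h * beta (Y s) - beta (Z (s + h) - Z s)| <= h * (e / 2).
  move=> s0 hs; have HYs := HY s0.
  have HhY := lin_closedZ Hlin h HYs.
  have HZZ : H (Z (s + h) - Z s) by apply: lin_closedB => //; apply: HZ; rewrite ?addr_ge0// ltW.
  have Hd := lin_closedB Hlin HZZ HhY.
  have bs : beta (Z (s + h) - Z s - h *: Y s) <= h * (e / 2).
    apply: le_trans (seminorm_le Hd) _; apply: le_trans (ler_wpM2l (ltW C0) hs) _.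
    by rewrite le_eqVlt; apply/orP; left; apply/eqP; field; rewrite gt_eqF.
  have hYE : h * beta (Y s) = beta (h *: Y s) by rewrite (seminormZ Hlin BP)// gtr0_norm.
  have t1 : beta (Z (s + h) - Z s) <= beta (Z (s + h) - Z s - h *: Y s) + beta (h *: Y s).
    have := seminormD Hlin BP Hd HhY; rewrite subrK; exact.
  have t2 : beta (h *: Y s) <= beta (Z (s + h) - Z s - h *: Y s) + beta (Z (s + h) - Z s).
    have Hd' := lin_closedB Hlin HhY HZZ.
    by rewrite (seminormBC Hlin BP)//; have := seminormD Hlin BP Hd' HZZ; rewrite subrK; exact.
  by rewrite hYE ler_distl; apply/andP; split; lra.
have k1 := key t t0 h1.
have := key 0 (lexx 0); rewrite add0r => /(_ h2) k2.
have := increment_decay hp t0 => dec.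
move: k1 k2; rewrite !ler_distl => /andP[_ k1] /andP[k2 _].
rewrite -(ler_pM2l hp).
have e0' := expR_ge0 (- (c / 2) * t).
set E := expR _ in dec et1 e0' *.
have he0 : 0 <= h * (e / 2) by rewrite mulr_ge0 ?divr_ge0 ?ltW.
have k3 : beta (Z h - Z 0) * E <= (h * beta (Y 0) + h * (e / 2)) * E by rewrite ler_wpM2r//; lra.
have k4 : h * (e / 2) * E <= h * (e / 2) by rewrite -[leRHS]mulr1 ler_wpM2l.
rewrite mulrDl in k3; rewrite mulrDr mulrA.
lra.
Qed.

End WeakIntegral.

(** * Square-integrable functions and primitives *)

Section SquareIntegrable.
Context d (X : measurableType d) (R : realType) (mu : {measure set X -> \bar R}).
Variables (D : set X) (mD : measurable D).
Implicit Types f g p : X -> R.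
Local Notation L2 := (square_integrable mu D).
Local Notation L1 f := (mu.-integrable D (EFin \o f)).

Lemma ae_mono (P Q : X -> Prop) : (forall x, P x -> Q x) ->
  {ae mu, forall x, P x} -> {ae mu, forall x, Q x}.
Proof. exact: filterS. Qed.

Lemma ae_mono2 (P Q S : X -> Prop) : (forall x, P x -> Q x -> S x) ->
  {ae mu, forall x, P x} -> {ae mu, forall x, Q x} -> {ae mu, forall x, S x}.
Proof. exact: filterS2. Qed.

Lemma ae_eqW f g : (forall x, D x -> f x = g x) -> ae_eq mu D f g.
Proof. by move=> fg; exact: aeW. Qed.

Lemma integrable_bound f g : measurable_fun D f -> (forall x, D x -> `|f x| <= g x) ->
  L1 g -> L1 f.
Proof.
move=> mf fg; apply: le_integrable => //; first exact/measurable_EFinP.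
by move=> x Dx /=; rewrite lee_fin (le_trans (fg x Dx))// ler_norm.
Qed.

Lemma integrable_measurable f : L1 f -> measurable_fun D f.
Proof. by move=> /measurable_int /measurable_EFinP. Qed.

Lemma L1D f g : L1 f -> L1 g -> L1 (fun x => f x + g x).
Proof.
move=> f1 g1; apply: eq_integrable (integrableD mD f1 g1) => // x _ /=.
Qed.

Lemma L1Z (r : R) f : L1 f -> L1 (fun x => r * f x).
Proof.
move=> f1; apply: eq_integrable (integrableZl mD r f1) => // x _ /=.
Qed.

Lemma L1Zr (r : R) f : L1 f -> L1 (fun x => f x * r).
Proof.
by move=> f1; apply: eq_integrable (integrableZl mD r f1) => // x _ /=; rewrite -EFinM mulrC.
Qed.

Lemma L1B f g : L1 f -> L1 g -> L1 (fun x => f x - g x).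
Proof.
move=> f1 g1; apply: eq_integrable (integrableB mD f1 g1) => // x _ /=.
Qed.

Lemma L1_bounded f g (K : R) : measurable_fun D f -> (forall x, D x -> `|f x| <= K) ->
  L1 g -> L1 (fun x => f x * g x).
Proof.
move=> mf fK g1; apply: (@integrable_bound _ (fun x => K * `|g x|)).
- exact: measurable_funM mf (integrable_measurable g1).
- by move=> x Dx; rewrite normrM ler_wpM2r// fK.
- by apply: L1Z; exact: integrable_norm.
Qed.

Lemma L1_bool f (r : X -> bool) : measurable_fun D r -> L1 f -> L1 (fun x => f x * (r x)%:R).
Proof.
move=> mr f1; have mf := integrable_measurable f1.
apply: (@integrable_bound _ (fun x => `|f x|)); last exact: integrable_norm.
  apply: measurable_funM => //.
  rewrite (_ : (fun z => _) = fun z => if r z then 1 else 0 : R); last first.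
    by apply/funext => z; case: (r z).
  exact: measurable_fun_if.
by move=> z _; rewrite normrM; case: (r z); rewrite ?normr1 ?normr0 ?mulr1 ?mulr0.
Qed.

Lemma L2_mul f g : L2 f -> L2 g -> L1 (fun x => f x * g x).
Proof.
move=> [mf f2] [mg g2].
apply: (@integrable_bound _ (fun x => f x ^+ 2 + g x ^+ 2)).
- exact: measurable_funM.
- by move=> x _; rewrite ler_norml; apply/andP; split; nra.
- exact: L1D.
Qed.

Lemma L2_lin (r : R) f g : L2 f -> L2 g -> L2 (fun x => r * f x + g x).
Proof.
move=> f2 g2; have [[mf if2] [mg ig2]] := (f2, g2).
have mfg : measurable_fun D (fun x => r * f x + g x).
  by apply: measurable_funD => //; apply: measurable_funM.
split => //.
apply: (@integrable_bound _ (fun x => 2 * r ^+ 2 * f x ^+ 2 + 2 * g x ^+ 2)).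
- exact: measurable_funX.
- move=> x _; rewrite ger0_norm ?sqr_ge0// -subr_ge0.
  by rewrite (_ : _ - _ = (r * f x - g x) ^+ 2) ?sqr_ge0//; ring.
- by apply: L1D => //; exact: L1Z.
Qed.

Lemma L2_bounded p f (K : R) : measurable_fun D p -> (forall x, D x -> `|p x| <= K) ->
  L2 f -> L2 (fun x => p x * f x).
Proof.
move=> mp pK [mf if2]; have mpf : measurable_fun D (fun x => p x * f x) by exact: measurable_funM.
split => //; apply: (@integrable_bound _ (fun x => K ^+ 2 * f x ^+ 2)).
- exact: measurable_funX.
- move=> x Dx; rewrite ger0_norm ?sqr_ge0// exprMn ler_wpM2r ?sqr_ge0//.
  by rewrite -[leLHS]real_normK ?num_real// ler_pXn2r ?nnegrE// ?(le_trans _ (pK x Dx)) ?pK.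
- exact: L1Z.
Qed.

Lemma ae_eq_Rintegral f g : measurable_fun D f -> measurable_fun D g -> ae_eq mu D f g ->
  \int[mu]_(x in D) f x = \int[mu]_(x in D) g x.
Proof.
move=> mf mg fg; congr fine; apply: ae_eq_integral => //; try exact/measurable_EFinP.
by apply: ae_mono fg => x + Dx => ->.
Qed.

Lemma ae_eq_integrable f g : measurable_fun D g -> ae_eq mu D f g -> L1 f -> L1 g.
Proof.
move=> mg fg /integrableP[mf fi]; apply/integrableP; split; first exact/measurable_EFinP.
move: fi; congr (_ < _)%E; apply: ae_eq_integral => //.
- exact: measurableT_comp.
- by apply: measurableT_comp => //; apply/measurable_EFinP.
- by apply: ae_mono fg => x + Dx => /= ->.
Qed.

(** The weights in use are 1, the multiplier [x], and [2 - s] for the history. *)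
Definition wpair p f g := \int[mu]_(x in D) (p x * (f x * g x)).

Variables (p : X -> R) (K : R).
Hypotheses (mp : measurable_fun D p) (pK : forall x, D x -> `|p x| <= K).

Lemma wpair_integrable f g : L2 f -> L2 g -> L1 (fun x => p x * (f x * g x)).
Proof.
move=> f2 g2; have := L2_mul (L2_bounded mp pK f2) g2.
by apply: eq_integrable => // x _ /=; rewrite mulrA.
Qed.

Lemma wpairC f g : wpair p f g = wpair p g f.
Proof. by apply: eq_Rintegral => x _; rewrite (mulrC (f x)). Qed.

Lemma wpair_lin (r : R) f g h : L2 f -> L2 g -> L2 h ->
  wpair p (fun x => r * f x + g x) h = r * wpair p f h + wpair p g h.
Proof.
move=> f2 g2 h2; rewrite /wpair -RintegralZl//; last exact: wpair_integrable.
rewrite -RintegralD//; [|exact: L1Z (wpair_integrable _ _)|exact: wpair_integrable].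
by apply: eq_Rintegral => x _; ring.
Qed.

Lemma wpair_ge0 f : (forall x, D x -> 0 <= p x) -> 0 <= wpair p f f.
Proof. by move=> p0; apply: Rintegral_ge0 => x Dx; rewrite mulr_ge0 ?p0// -expr2 sqr_ge0. Qed.

(** Young's inequality under the integral, applied to [f] and [k^-1 * g]. *)
Lemma wpair_le f g (k : R) : L2 f -> L2 g -> 0 < k -> 0 <= K ->
  `|wpair p f g| <= K / 2 * (k * \int[mu]_(x in D) f x ^+ 2 + k^-1 * \int[mu]_(x in D) g x ^+ 2).
Proof.
move=> f2 g2 k0 K0; have [[mf if2] [mg ig2]] := (f2, g2).
apply: le_trans (le_normr_Rintegral mD (wpair_integrable f2 g2)) _.
rewrite -!RintegralZl// -RintegralD//; try exact: L1Z.
rewrite -RintegralZl//; last by apply: L1D => //; exact: L1Z.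
apply: le_Rintegral => //.
- by have /integrable_norm := wpair_integrable f2 g2.
- by apply: L1Z => //; apply: L1D => //; exact: L1Z.
- move=> x Dx; rewrite normrM.
  apply: (@le_trans _ _ (K * `|f x * g x|)); first by rewrite ler_wpM2r// pK.
  rewrite -mulrA ler_wpM2l// [leRHS]mulrC ler_pdivlMr//.
  have -> : k^-1 * g x ^+ 2 = k * (k^-1 * g x) ^+ 2 by field; rewrite gt_eqF.
  have -> : f x * g x = k * (f x * (k^-1 * g x)) by field; rewrite gt_eqF.
  rewrite normrM gtr0_norm// -mulrA -mulrDr ler_wpM2l ?(ltW k0)// normrM.
  rewrite -[X in X + _]real_normK ?num_real// -[X in _ + X]real_normK ?num_real//; have := sqr_ge0
    (`|f x| - `|k^-1 * g x|); rewrite sqrrB mulr2n; lra.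
Qed.

Lemma wpair_ae_eq f f' g g' : L2 f -> L2 f' -> L2 g -> L2 g' ->
  ae_eq mu D f f' -> ae_eq mu D g g' -> wpair p f g = wpair p f' g'.
Proof.
move=> f2 f'2 g2 g'2 ff' gg'; apply: ae_eq_Rintegral.
- exact: integrable_measurable (wpair_integrable _ _).
- exact: integrable_measurable (wpair_integrable _ _).
- by apply: ae_mono2 ff' gg' => x + + Dx => -> // ->.
Qed.

End SquareIntegrable.

(** * Calculus of absolutely continuous functions *)

Section Primitives.
Variable R : realType.
Notation mu := (@lebesgue_measure R).

(* [f] is absolutely continuous on [[a, b]], with derivative [f']. *)
Definition is_primitive (a b : R) (f f' : R -> R) :=
  mu.-integrable `[a, b] (EFin \o f') /\
  forall x, x \in `[a, b] -> f x = f a + \int[mu]_(r in `[a, x]) f' r.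

Lemma is_primitive_continuous (a b : R) f f' : a <= b -> is_primitive a b f f' ->
  {within `[a, b], continuous f}.
Proof.
move=> ab [if' fE].
have := parameterized_integral_continuous ab if' => c.
have c2 : {within `[a, b], continuous (fun x => f a + \int[mu]_(r in `[a, x]) f' r)}.
  by move=> x; apply: cvgD; [exact: cvg_cst|exact: c].
apply: subspace_eq_continuous c2 => x; rewrite inE => xab.
exact: esym (fE x xab).
Qed.

Lemma is_primitive_bounded (a b : R) f f' : a <= b -> is_primitive a b f f' ->
  exists K, forall x, x \in `[a, b] -> `|f x| <= K.
Proof.
move=> ab fP; have cf := is_primitive_continuous ab fP.
have cnf : {within `[a, b], continuous (fun x => `|f x|)}.
  by move=> x; apply: cvg_norm; exact: cf.
by have [c _ h] := EVT_max ab cnf; exists `|f c|.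
Qed.

Lemma is_primitive_measurable (a b : R) f f' : a <= b -> is_primitive a b f f' ->
  measurable_fun (T := measurableTypeR R) `[a, b] f.
Proof.
move=> ab fP; apply: subspace_continuous_measurable_fun => //.
exact: is_primitive_continuous fP.
Qed.

Lemma is_primitiveD (a b : R) f f' g g' : is_primitive a b f f' -> is_primitive a b g g' ->
  is_primitive a b (fun x => f x + g x) (fun x => f' x + g' x).
Proof.
move=> [if' fE] [ig' gE]; split; first exact: L1D.
move=> x xab; rewrite (fE x xab) (gE x xab).
have sub : [set` `[a, x]] `<=` [set` `[a, b]].
  by apply: subset_itvl; move: xab; rewrite in_itv/= bnd_simp => /andP[].
have := @RintegralD _ _ _ mu `[a, x] f' g'.
move=> ->//; [by ring|exact: integrableS if'|exact: integrableS ig'].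
Qed.

Lemma is_primitiveZ (a b r : R) f f' : is_primitive a b f f' ->
  is_primitive a b (fun x => r * f x) (fun x => r * f' x).
Proof.
move=> [if' fE]; split; first exact: L1Z.
move=> x xab; rewrite (fE x xab).
have sub : [set` `[a, x]] `<=` [set` `[a, b]].
  by apply: subset_itvl; move: xab; rewrite in_itv/= bnd_simp => /andP[].
by rewrite RintegralZl ?mulrDr//; exact: integrableS if'.
Qed.

Lemma itv_integrable_cst (a b r : R) : mu.-integrable `[a, b] (EFin \o (fun=> r)).
Proof.
apply: continuous_compact_integrable; first exact: segment_compact.
exact/continuous_subspaceT/cst_continuous.
Qed.

Lemma is_primitive_cst (a b r : R) : is_primitive a b (fun=> r) (fun=> 0).
Proof.
split; first exact: itv_integrable_cst.
by move=> x xab; rewrite Rintegral_cst// mul0r addr0.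
Qed.

Lemma is_primitive_id (a b : R) : is_primitive a b (fun x => x) (fun=> 1).
Proof.
split; first exact: itv_integrable_cst.
move=> x; rewrite in_itv/= => /andP[ax _].
have mux : fine (mu `[a, x]%classic) = x - a.
  by rewrite lebesgue_measure_itv/= lte_fin; case: ltgtP ax => // -> _; rewrite subrr.
by rewrite Rintegral_cst// mul1r mux addrC subrK.
Qed.

Lemma is_primitive_sub (a b c : R) f f' : c <= b -> is_primitive a b f f' ->
  is_primitive a c f f'.
Proof.
move=> cb [if' fE]; have sub : [set` `[a, c]] `<=` [set` `[a, b]].
  by apply: subset_itvl; rewrite bnd_simp.
by split; [exact: integrableS if'|move=> x /sub/fE].
Qed.

Lemma integrable_tensor (p q : R -> R) : mu.-integrable setT (EFin \o p) ->
  mu.-integrable setT (EFin \o q) ->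
  (lebesgue2 R).-integrable setT (EFin \o (fun z => p z.1 * q z.2)).
Proof.
move=> ip iq.
have mpq : measurable_fun setT (fun z : R * R => p z.1 * q z.2).
  apply: measurable_funM; first exact: measurableT_comp (integrable_measurable ip) measurable_fst.
  exact: measurableT_comp (integrable_measurable iq) measurable_snd.
apply/integrable12ltyP; first exact/measurable_EFinP.
have iap := integrable_norm ip; have iaq := integrable_norm iq.
under eq_integral => x _.
  under eq_integral => y _ do rewrite /= normrM EFinM.
  rewrite integralZl//.
  over.
have fq : (\int[mu]_y (`|q y|)%:E)%E \is a fin_num by exact: integrable_fin_num.
rewrite -(fineK fq) integralZr//.
by rewrite -(fineK (integrable_fin_num _ iap))// -EFinM ltry.
Qed.

Lemma is_primitive_integral (a b x : R) f f' : is_primitive a b f f' -> x \in `[a, b] ->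
  (\int[mu]_(y in `[a, x]) (f' y)%:E = (f x - f a)%:E)%E.
Proof.
move=> [if' fE] xab; rewrite (fE x xab) addrAC subrr add0r fineK//.
apply: integrable_fin_num => //; apply: integrableS if' => //; apply: subset_itvl.
by move: xab; rewrite in_itv/= bnd_simp => /andP[].
Qed.

Lemma is_primitive_integral_le (a b x : R) f f' : is_primitive a b f f' -> x \in `[a, b] ->
  (\int[mu]_y ((f' \_ `[a, b]) y * (y <= x)%R%:R)%:E = (f x - f a)%:E)%E.
Proof.
move=> fP xab; rewrite -(is_primitive_integral fP xab) [RHS]integral_mkcond.
apply: eq_integral => y _; rewrite !patchE !mem_setE !in_itv/=.
move: xab; rewrite in_itv/= => /andP[ax xb].
have [yx|yx] := leP y x; last by rewrite mulr0 andbF.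
by rewrite mulr1 andbT (le_trans yx xb) andbT; case: ifP.
Qed.

(** The strict counterpart of the previous lemma: [<=] and [<] split the square into two disjoint
    triangles, so the diagonal is counted exactly once. The end point [x] is a null set for the
    integral. *)
Lemma is_primitive_integral_lt (a b x : R) f f' : is_primitive a b f f' -> x \in `[a, b] ->
  (\int[mu]_y ((f' \_ `[a, b]) y * (y < x)%R%:R)%:E = (f x - f a)%:E)%E.
Proof.
move=> fP xab; rewrite -(is_primitive_integral fP xab).
move: (xab); rewrite in_itv/= => /andP[ax xb].
rewrite -integral_itv_bndo_bndc; last first.
  apply: (measurable_funS _ _ (measurable_int _ (fP.1))) => //.
  by apply: subset_itv; rewrite bnd_simp.
rewrite [RHS]integral_mkcond.
apply: eq_integral => y _; rewrite !patchE !mem_setE !in_itv/=.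
have [yx|yx] := ltP y x; last by rewrite mulr0 andbF.
by rewrite mulr1 andbT (le_trans (ltW yx) xb) andbT; case: ifP.
Qed.

(* Fubini on the square, split along the diagonal. *)
Lemma is_primitive_by_parts (a b : R) f f' g g' : a <= b ->
  is_primitive a b f f' -> is_primitive a b g g' ->
  \int[mu]_(x in `[a, b]) (f' x * (g x - g a)) + \int[mu]_(x in `[a, b]) (g' x * (f x - f a))
  = (f b - f a) * (g b - g a).
Proof.
move=> ab fP gP.
pose p := f' \_ `[a, b]; pose q := g' \_ `[a, b].
have ip : mu.-integrable setT (EFin \o p).
  by rewrite /p -restrict_EFin; apply/(integrable_mkcond _ _).1 => //; exact: fP.1.
have iq : mu.-integrable setT (EFin \o q).
  by rewrite /q -restrict_EFin; apply/(integrable_mkcond _ _).1 => //; exact: gP.1.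
have i1 : (lebesgue2 R).-integrable setT
    (EFin \o (fun z => p z.1 * q z.2 * (z.2 <= z.1)%R%:R)).
  apply: (L1_bool _ _ (integrable_tensor ip iq)) => //.
  exact: measurable_fun_ler measurable_snd measurable_fst.
have i2 : (lebesgue2 R).-integrable setT
    (EFin \o (fun z => p z.1 * q z.2 * (z.1 < z.2)%R%:R)).
  apply: (L1_bool _ _ (integrable_tensor ip iq)) => //.
  exact: measurable_fun_ltr measurable_fst measurable_snd.
have i0 := integrable_tensor ip iq.
have bab : b \in `[a, b] by rewrite in_itv/= ab lexx.
have E1 : \int[lebesgue2 R]_z (p z.1 * q z.2 * (z.2 <= z.1)%R%:R) =
    \int[mu]_(x in `[a, b]) (f' x * (g x - g a)).
  rewrite [RHS]Rintegral_mkcond; congr fine.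
  apply: (etrans (esym (integral12_prod_meas1 i1))); rewrite /fubini_F/=.
  apply: eq_integral => x _; rewrite patchE mem_setE.
  under eq_integral do rewrite -mulrA EFinM.
  rewrite integralZl//; last by apply: (L1_bool _ _ iq) => //; exact: measurable_fun_ler.
  rewrite /p patchE mem_setE; case: ifPn => xab; last by rewrite mul0e.
  by rewrite (is_primitive_integral_le gP).
have E2 : \int[lebesgue2 R]_z (p z.1 * q z.2 * (z.1 < z.2)%R%:R) =
    \int[mu]_(x in `[a, b]) (g' x * (f x - f a)).
  rewrite [RHS]Rintegral_mkcond; congr fine.
  apply: (etrans (esym (integral21_prod_meas1 i2))); rewrite /fubini_G/=.
  apply: eq_integral => x _; rewrite patchE mem_setE.
  under eq_integral do rewrite mulrAC EFinM.
  rewrite integralZr//; last by apply: (L1_bool _ _ ip) => //; exact: measurable_fun_ltr.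
  rewrite /q patchE mem_setE; case: ifPn => xab; last by rewrite mule0.
  by rewrite (is_primitive_integral_lt fP)// -EFinM mulrC.
have E0 : \int[lebesgue2 R]_z (p z.1 * q z.2) = (f b - f a) * (g b - g a).
  transitivity (fine ((f b - f a) * (g b - g a))%:E) => //; congr fine.
  apply: (etrans (esym (integral12_prod_meas1 i0))); rewrite /fubini_F/=.
  under eq_integral => x _.
    under eq_integral do rewrite EFinM.
    rewrite integralZl//.
    over.
  have -> : (\int[mu]_y (q y)%:E = (g b - g a)%:E)%E.
    rewrite -(is_primitive_integral gP bab) [RHS]integral_mkcond.
    by apply: eq_integral => y _; rewrite /q !patchE; case: ifP.
  rewrite integralZr//.
  have -> : (\int[mu]_y (p y)%:E = (f b - f a)%:E)%E.
    rewrite -(is_primitive_integral fP bab) [RHS]integral_mkcond.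
    by apply: eq_integral => y _; rewrite /p !patchE; case: ifP.
  by [].
rewrite -E1 -E2 -E0 -RintegralD//; apply: eq_Rintegral => z _.
by rewrite -mulrDr; case: ltP => _; rewrite ?add0r ?addr0 mulr1.
Qed.

(** Integration by parts on each [[a, x]]; the products are integrable because primitives are
    continuous, hence bounded. *)
Lemma is_primitiveM (a b : R) f f' g g' : a <= b -> is_primitive a b f f' -> is_primitive a b g g'
  ->
  is_primitive a b (fun x => f x * g x) (fun x => f' x * g x + f x * g' x).
Proof.
move=> ab fP gP.
have [K fK] := is_primitive_bounded ab fP; have mf := is_primitive_measurable ab fP.
have [L gL] := is_primitive_bounded ab gP; have mg := is_primitive_measurable ab gP.
have ifg' : mu.-integrable `[a, b] (EFin \o (fun x => f x * g' x)).
  exact: L1_bounded _ mf fK gP.1.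
have if'g : mu.-integrable `[a, b] (EFin \o (fun x => f' x * g x)).
  have : mu.-integrable `[a, b] (EFin \o (fun x => g x * f' x)).
    exact: L1_bounded _ mg gL fP.1.
  by apply: eq_integrable => // y _ /=; rewrite mulrC.
split; first exact: L1D.
move=> x xab; move: (xab); rewrite in_itv/= => /andP[ax xb].
have sub : [set` `[a, x]] `<=` [set` `[a, b]] by apply: subset_itvl; rewrite bnd_simp.
have := is_primitive_by_parts ax (is_primitive_sub xb fP) (is_primitive_sub xb gP).
have jf : mu.-integrable `[a, x] (EFin \o f') by apply: integrableS (fP.1).
have jg : mu.-integrable `[a, x] (EFin \o g') by apply: integrableS (gP.1).
have jfg' : mu.-integrable `[a, x] (EFin \o (fun x => f x * g' x)) by apply: integrableS ifg'.
have jf'g : mu.-integrable `[a, x] (EFin \o (fun x => f' x * g x)) by apply: integrableS if'g.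
rewrite RintegralD//.
have -> : \int[mu]_(x0 in `[a, x]) (f' x0 * (g x0 - g a)) =
   \int[mu]_(x0 in `[a, x]) (f' x0 * g x0) - (f x - f a) * g a.
  have -> : f x - f a = \int[mu]_(x0 in `[a, x]) f' x0 by rewrite (fP.2 x xab); ring.
  rewrite -RintegralZr// -RintegralB//; last exact: L1Zr.
  by apply: eq_Rintegral => y _; ring.
have -> : \int[mu]_(x0 in `[a, x]) (g' x0 * (f x0 - f a)) =
   \int[mu]_(x0 in `[a, x]) (f x0 * g' x0) - f a * (g x - g a).
  have -> : g x - g a = \int[mu]_(x0 in `[a, x]) g' x0 by rewrite (gP.2 x xab); ring.
  rewrite -RintegralZl// -RintegralB//; last exact: L1Z.
  by apply: eq_Rintegral => y _; ring.
move=> h; lra.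
Qed.
End Primitives.

(** * Uniqueness of derivatives *)

Section Jets.
Variable R : realType.
Notation mu := (@lebesgue_measure R).

(** Lebesgue differentiation: the extension [G] of [g] by zero has a vanishing primitive on the
    whole line, and almost everywhere [G] is the derivative of that primitive. *)
Lemma ae_eq0_of_primitive (a b : R) (g : R -> R) : mu.-integrable `[a, b] (EFin \o g) ->
  (forall x, x \in `[a, b] -> \int[mu]_(r in `[a, x]) g r = 0) ->
  ae_eq mu `[a, b]%classic g (cst 0).
Proof.
move=> ig g0; pose G := g \_ `[a, b].
have iG : mu.-integrable setT (EFin \o G).
  by rewrite /G -restrict_EFin; apply/(integrable_mkcond _ _).1.
have F0 : (fun x => \int[mu]_(t in `[a, x]) G t) = cst 0.
  apply/funext => x; rewrite /G -Rintegral_mkcondr.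
  have [xa|ax] := ltP x a.
    by rewrite set_itv_ge ?set0I ?Rintegral_set0// bnd_simp -ltNge.
  have [xb|bx] := leP x b.
    rewrite (_ : _ `&` _ = [set` `[a, x]]); first by apply: g0; rewrite in_itv/= ax xb.
    by apply: setIidl; apply: subset_itvl; rewrite bnd_simp.
  rewrite setIidr; last by apply: subset_itvl; rewrite bnd_simp ltW.
  have [ab|ba] := leP a b; first by apply: g0; rewrite in_itv/= ab lexx.
  by rewrite set_itv_ge ?Rintegral_set0// bnd_simp -ltNge.
have iGy y : mu.-integrable [set` Interval (BLeft a) (BRight y)] (EFin \o G).
  exact: integrableS iG.
have xa : {ae mu, forall x, x != a}.
  exists [set a]; split; [exact: measurable_set1|exact: lebesgue_measure_set1|].
  by move=> x /= /negP; rewrite negbK => /eqP.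
have := FTC1 iGy (integrable_locally_restrict (measurable_itv _) ig).
apply: ae_mono2 xa => x xa h xab.
have ax : a < x by rewrite lt_neqAle eq_sym xa; move: xab; rewrite /= in_itv/= => /andP[].
have [_] := h ax.
rewrite F0 derive1_cst /G patchE mem_set// => <-; by [].
Qed.

Lemma is_primitive_ae_unique (a b : R) f g f' g' : is_primitive a b f f' -> is_primitive a b g g' ->
  (forall x, x \in `[a, b] -> f x = g x) -> ae_eq mu `[a, b]%classic f' g'.
Proof.
move=> fP gP fg.
have dP := is_primitiveD fP (is_primitiveZ (-1) gP).
have : ae_eq mu `[a, b]%classic (fun x => f' x + -1 * g' x) (cst 0).
  apply: ae_eq0_of_primitive; first exact: dP.1.
  move=> x xab; have [_ /(_ x xab)] := dP.
  have aab : a \in `[a, b] by move: xab; rewrite !in_itv/= lexx => /andP[ax xb]; exact: le_trans xb.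
  by rewrite (fg x xab) (fg a aab); lra.
by apply: ae_mono => x + xab => /(_ xab)/=; lra.
Qed.

(* [d ^+ 2] has derivative [2 * d * e], which vanishes almost everywhere, so it is constant. *)
Lemma ae_eq0_is_primitive (a b : R) d e : a < b -> is_primitive a b d e ->
  ae_eq mu `[a, b]%classic d (cst 0) -> forall x, x \in `[a, b] -> d x = 0.
Proof.
move=> ab dP d0.
have d2P := is_primitiveM (ltW ab) dP dP.
have md := is_primitive_measurable (ltW ab) dP.
have d2 x : x \in `[a, b] -> d x * d x = d a * d a.
  move=> xab; rewrite (d2P.2 x xab).
  have sub : [set` `[a, x]] `<=` [set` `[a, b]].
    by apply: subset_itvl; move: xab; rewrite in_itv/= bnd_simp => /andP[].
  rewrite (@ae_eq_Rintegral _ _ _ mu _ _ _ (cst 0)) ?Rintegral_cst// ?mul0r ?addr0//.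
    by apply: integrable_measurable; apply: integrableS (d2P.1).
  by apply: ae_mono d0 => y /= dy yax; rewrite (dy (sub _ yax)) !(mulr0, mul0r) addr0.
(* The constant value of [d ^+ 2] is found by integrating it over an interval of positive length. *)
have : \int[mu]_(x in `[a, b]) (d a * d a) = 0.
  rewrite -(@eq_Rintegral _ _ _ mu _ _ (fun x => d x * d x)); last first.
    by move=> x; rewrite inE => /d2.
  rewrite (@ae_eq_Rintegral _ _ _ mu _ _ _ (cst 0)) ?Rintegral_cst// ?mul0r//.
    exact: measurable_funM.
  by apply: ae_mono d0 => y /= dy yax; rewrite (dy yax) mulr0.
have muab : fine (mu `[a, b]%classic) = b - a.
  by rewrite lebesgue_measure_itv/= lte_fin ab.
rewrite Rintegral_cst// muab => /eqP; rewrite mulf_eq0 subr_eq0 (gt_eqF ab) orbF => /eqP da0.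
by move=> x /d2; rewrite da0 => /eqP; rewrite mulf_eq0 orbb => /eqP.
Qed.

Lemma L2_itv_integrable (a b : R) f : square_integrable mu `[a, b] f ->
  mu.-integrable `[a, b] (EFin \o f).
Proof.
move=> [mf if2]; apply: (@integrable_bound _ _ _ mu _ _ _ (fun x => 1 + f x ^+ 2)) => //.
  move=> x _; rewrite ler_norml; apply/andP; split.
    by have := sqr_ge0 (f x + 1); rewrite sqrrD; nra.
  by have := sqr_ge0 (f x - 1); rewrite sqrrB; nra.
by apply: L1D => //; exact: itv_integrable_cst.
Qed.

Lemma sobolev_jet_is_primitive (a b : R) n f j k : sobolev_jet a b n f j -> (k < n)%N ->
  is_primitive a b (j k) (j k.+1).
Proof.
move=> [_ jL2 jP] kn; split; last by move=> x; exact: jP.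
exact: L2_itv_integrable (jL2 _ _).
Qed.

Lemma sobolev_jet_leq (a b : R) n m f j : (m <= n)%N -> sobolev_jet a b n f j ->
  sobolev_jet a b m f j.
Proof.
move=> mn [j0 jL2 jP]; split=> // [k km|k x km]; first by apply: jL2; exact: leq_trans mn.
by apply: jP; exact: leq_trans mn.
Qed.

Lemma sobolev_jet_eq (a b : R) n f g j : (forall x, x \in `[a, b] -> f x = g x) ->
  sobolev_jet a b n f j -> sobolev_jet a b n g j.
Proof. by move=> fg [j0 jL2 jP]; split=> // x xab; rewrite j0// fg. Qed.

Lemma sobolev_jet_lin (a b r : R) n f g j i : sobolev_jet a b n f j -> sobolev_jet a b n g i ->
  sobolev_jet a b n (fun x => r * f x + g x) (fun k x => r * j k x + i k x).
Proof.
move=> jP iP; have [[j0 jL2 _] [i0 iL2 _]] := (jP, iP); split.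
- by move=> x xab; rewrite j0// i0.
- by move=> k kn; apply: L2_lin => //; [exact: jL2|exact: iL2].
- move=> k x kn; have := is_primitiveD (is_primitiveZ r (sobolev_jet_is_primitive jP kn))
    (sobolev_jet_is_primitive iP kn).
  by case=> _; apply.
Qed.

(** Induction on the order: equal functions have almost everywhere equal derivatives, and below the
    top order these are again primitives, for which equality almost everywhere is equality
    everywhere. *)
Lemma sobolev_jet_unique (a b : R) n f j i : a < b -> sobolev_jet a b n f j ->
  sobolev_jet a b n f i -> forall k, (k < n)%N -> forall x, x \in `[a, b] -> j k x = i k x.
Proof.
move=> ab jP iP; elim=> [_ x xab|k IH kn x xab].
  by case: jP => j0 _ _; case: iP => i0 _ _; rewrite j0// i0.
have kn' := ltnW kn.
have ae := is_primitive_ae_unique (sobolev_jet_is_primitive jP kn')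
  (sobolev_jet_is_primitive iP kn') (IH kn').
have dP := is_primitiveD (sobolev_jet_is_primitive jP kn)
  (is_primitiveZ (-1) (sobolev_jet_is_primitive iP kn)).
have := ae_eq0_is_primitive ab dP.
have : ae_eq mu `[a, b]%classic (fun x => j k.+1 x + -1 * i k.+1 x) (cst 0).
  by apply: ae_mono ae => y + yab => -> //=; lra.
by move=> /[swap]/[apply] /(_ x xab); lra.
Qed.

Lemma sobolev_jet_ae_unique (a b : R) n f j i : a < b -> sobolev_jet a b n f j ->
  sobolev_jet a b n f i -> forall k, (k <= n)%N -> ae_eq mu `[a, b]%classic (j k) (i k).
Proof.
move=> ab jP iP k; rewrite leq_eqVlt => /predU1P[->|kn]; last first.
  by apply: aeW => x xab; exact: sobolev_jet_unique jP iP _ kn _ xab.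
case: n => [|n] in jP iP *.
  apply: aeW => x xab; by case: jP => j0 _ _; case: iP => i0 _ _; rewrite j0// i0.
exact: is_primitive_ae_unique (sobolev_jet_is_primitive jP (ltnSn n))
  (sobolev_jet_is_primitive iP (ltnSn n)) (sobolev_jet_unique ab jP iP (ltnSn n)).
Qed.

Lemma sobolev_derivP (a b : R) n f : sobolev a b n f ->
  sobolev_jet a b n f (sobolev_deriv a b n f).
Proof. by move=> [j jP]; exact: (@xgetPex _ (fun _ _ => 0) [set j | sobolev_jet a b n f j]
  (ex_intro _ j jP)). Qed.

End Jets.

(** * Bilinear forms on states *)

Section Features.
Context d (X : measurableType d) (R : realType) (mu : {measure set X -> \bar R}).
Variables (D : set X) (mD : measurable D) (V : lmodType R) (H : set V).
Local Notation L2 := (square_integrable mu D).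

(** Linearity is required only almost everywhere, because the second derivative of a position is a
    choice within its class; [wpair] does not see the difference. *)
Definition linear_feature (Phi : V -> X -> R) :=
  (forall Y, H Y -> L2 (Phi Y)) /\
  forall r Y W, H Y -> H W ->
    ae_eq mu D (Phi (r *: Y + W)) (fun x => r * Phi Y x + Phi W x).

Variables (p : X -> R) (K : R).
Hypotheses (mp : measurable_fun D p) (pK : forall x, D x -> `|p x| <= K).
Hypothesis Hlin : lin_closed H.

Lemma wpair_feature Phi r Y W g : linear_feature Phi -> H Y -> H W -> L2 g ->
  wpair mu D p (Phi (r *: Y + W)) g = r * wpair mu D p (Phi Y) g + wpair mu D p (Phi W) g.
Proof.
move=> [PL2 Plin] HY HW g2.
have := Plin r _ _ HY HW => e; have HYW := Hlin r HY HW.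
have L := L2_lin mD r (PL2 _ HY) (PL2 _ HW).
rewrite (wpair_ae_eq mD mp pK (PL2 _ HYW) L g2 g2 e); last exact: aeW.
by rewrite (wpair_lin mD mp pK)//; exact: PL2.
Qed.

Lemma sym_bilinear_diag Phi : linear_feature Phi ->
  sym_bilinear H (fun Y W => wpair mu D p (Phi Y) (Phi W)).
Proof.
move=> PP; split=> [Y W HY HW|r Y W Z HY HW HZ]; first exact: wpairC.
by apply: wpair_feature => //; exact: PP.1.
Qed.

Lemma sym_bilinear_cross Phi Psi : linear_feature Phi -> linear_feature Psi ->
  sym_bilinear H (fun Y W => wpair mu D p (Phi Y) (Psi W) + wpair mu D p (Phi W) (Psi Y)).
Proof.
move=> PP QP; split=> [Y W HY HW|r Y W Z HY HW HZ]; first exact: addrC.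
rewrite (wpair_feature _ PP)//; last exact: QP.1.
rewrite [X in _ + X = _]wpairC (wpair_feature _ QP)//; last exact: PP.1.
by rewrite [X in _ = _ * (_ + X) + _]wpairC [X in _ = _ + (_ + X)]wpairC; ring.
Qed.

End Features.

Section StateForms.
Variables (R : realType) (l : R).
Hypothesis l_gt0 : 0 < l.
Notation mu := (@lebesgue_measure R).
Notation D := [set` `[0, l]].

Definition pos_deriv k (Y : state R) := sobolev_deriv 0 l 2 (pos Y) k.

(** A pointwise statement, needed to carry the clamped condition y'(0) = 0 over to linear
    combinations. *)
Lemma pos_deriv_lin r (Y W : state R) k x : inH l Y -> inH l W -> (k < 2)%N -> x \in `[0, l] ->
  pos_deriv k (r *: Y + W) x = r * pos_deriv k Y x + pos_deriv k W x.
Proof.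
move=> [[/sobolev_derivP Yj _] _ _] [[/sobolev_derivP Wj _] _ _] kn xl.
have J := sobolev_jet_lin r Yj Wj.
exact: sobolev_jet_unique (sobolev_derivP (ex_intro _ _ J)) J k kn x xl.
Qed.

Lemma pos_deriv_ae_lin r (Y W : state R) k : inH l Y -> inH l W -> (k <= 2)%N ->
  ae_eq mu D (pos_deriv k (r *: Y + W)) (fun x => r * pos_deriv k Y x + pos_deriv k W x).
Proof.
move=> [[/sobolev_derivP Yj _] _ _] [[/sobolev_derivP Wj _] _ _] kn.
have J := sobolev_jet_lin r Yj Wj.
exact: sobolev_jet_ae_unique (sobolev_derivP (ex_intro _ _ J)) J k kn.
Qed.

Lemma inH_lin_closed : lin_closed (@inH R l).
Proof.
move=> r Y W HY HW; have [[[Y1 [Y2 Y3]] Y4 Y5] [[W1 [W2 W3]] W4 W5]] := (HY, HW).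
split; last 2 first.
- exact: L2_lin.
- by apply: L2_lin => //; exact: measurableX.
have J := sobolev_jet_lin r (sobolev_derivP Y1) (sobolev_derivP W1).
split; first by exists (fun k x => r * sobolev_deriv 0 l 2 (pos Y) k x + sobolev_deriv 0 l 2 (pos
  W) k x).
split; first by rewrite /pos/= -[LHS]/(r * pos Y 0 + pos W 0) Y2 W2 mulr0 addr0.
have := pos_deriv_lin r HY HW (isT : 1 < 2)%N (_ : 0 \in `[0, l]).
rewrite /pos_deriv Y3 W3 mulr0 addr0; apply; by rewrite in_itv/= lexx ltW.
Qed.

Lemma pos_deriv_feature k : (k <= 2)%N -> linear_feature mu D (@inH R l) (pos_deriv k).
Proof.
move=> k2; split=> [Y [[/sobolev_derivP[_ + _] _] _ _]|r Y W HY HW]; first exact.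
exact: pos_deriv_ae_lin.
Qed.

Lemma vel_feature : linear_feature mu D (@inH R l) (@vel R).
Proof. by split=> [Y []//|r Y W HY HW]; exact: aeW. Qed.

Lemma hist_feature : linear_feature (lebesgue2 R) (rect l) (@inH R l) (@hist R).
Proof. by split=> [Y []//|r Y W HY HW]; exact: aeW. Qed.

Lemma measurable_rect : measurable (rect l : set (measurableTypeR R * measurableTypeR R)).
Proof. exact: measurableX. Qed.

Lemma dotHE Y W : dotH l Y W =
  \sum_(k < 3) wpair mu D (cst 1) (pos_deriv k Y) (pos_deriv k W)
  + wpair mu D (cst 1) (vel Y) (vel W) + wpair (lebesgue2 R) (rect l) (cst 1) (hist Y) (hist W).
Proof.
by rewrite /dotH /wpair; congr (_ + _ + _); [apply: eq_bigr => k _|..];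
  apply: eq_Rintegral => x _; rewrite mul1r.
Qed.

Lemma wpair1 d (X : measurableType d) (m : {measure set X -> \bar R}) E f :
  wpair m E (cst 1) f f = \int[m]_(x in E) f x ^+ 2.
Proof. by apply: eq_Rintegral => x _; rewrite mul1r. Qed.

Lemma dotH_psd : psd_form (@inH R l) (dotH l).
Proof.
have n1 d (X : measurableType d) (E : set X) x : E x -> `|cst (1 : R) x| <= 1.
  by rewrite normr1.
split.
  (* The nested abstractions display the form as an iterated sum of forms, the shape that
     [sym_bilinearD] matches. *)
  have -> : dotH l = fun Y W => (fun Y W => (fun Y W =>
      (fun Y W => (fun Y W => wpair mu D (cst 1) (pos_deriv 0 Y) (pos_deriv 0 W)) Y W +
      wpair mu D (cst 1) (pos_deriv 1 Y) (pos_deriv 1 W)) Y W +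
      wpair mu D (cst 1) (pos_deriv 2 Y) (pos_deriv 2 W)) Y W +
      wpair mu D (cst 1) (vel Y) (vel W)) Y W +
      wpair (lebesgue2 R) (rect l) (cst 1) (hist Y) (hist W).
    by apply/funext => Y; apply/funext => W; rewrite dotHE !big_ord_recr big_ord0/= add0r.
  have HL := inH_lin_closed; have mR := measurable_rect.
  (apply: sym_bilinearD; first (apply: sym_bilinearD; first (apply: sym_bilinearD; first apply:
    sym_bilinearD)));
    apply: (@sym_bilinear_diag _ _ _ _ _ _ _ _ _ 1) => //;
    try exact: n1; by [exact: pos_deriv_feature|exact: vel_feature|exact: hist_feature].
move=> Y HY; rewrite dotHE !big_ord_recr big_ord0/= add0r.
by rewrite !addr_ge0 ?wpair_ge0// => *; exact: ler01.
Qed.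

End StateForms.

(** * Traces of the history *)

Section History.
Variables (R : realType) (l : R).
Hypothesis l_gt0 : 0 < l.
Notation mu := (@lebesgue_measure R).
Notation mu2 := (lebesgue2 R).
Local Notation mrect := (@measurable_rect R l).

Lemma rect_restrict (h : R * R -> R) x s :
  (h \_ (rect l)) (x, s) = if x \in `[0, l] then ((fun s => h (x, s)) \_ `[0, 1]) s else 0.
Proof.
rewrite !patchE.
have -> : ((x, s) \in rect l) = (x \in `[0, l]) && (s \in `[0, 1]%classic).
  by rewrite mem_setE; apply/idP/andP => [/set_mem[/= -> ->]//|[xl sl]]; apply/mem_set; split.
by case: (x \in _).
Qed.

Section RectFubini.
Variable h : R * R -> R.
Hypothesis ih : mu2.-integrable (rect l) (EFin \o h).

Let iH : mu2.-integrable setT (EFin \o (h \_ (rect l))).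
Proof. by rewrite -restrict_EFin; apply/(integrable_mkcond _ mrect).1. Qed.

Let inner x : (\int[mu]_s ((h \_ (rect l)) (x, s))%:E)%E =
  ((fun x => \int[mu]_(s in `[0%R, 1%R]) (h (x, s))%:E)%E \_ `[0, l]) x.
Proof.
rewrite patchE mem_setE; case: ifPn => xl; last first.
  under eq_integral => s _ do rewrite rect_restrict (negbTE xl).
  exact: integral0.
rewrite [RHS]integral_mkcond; apply: eq_integral => s _.
by rewrite rect_restrict xl !patchE; case: ifP.
Qed.

Lemma rect_ae_integrable : {ae mu, forall x, x \in `[0, l] ->
  mu.-integrable `[0, 1] (EFin \o (fun s => h (x, s)))}.
Proof.
apply: ae_mono (ae_integrable1 iH) => x + xl.
have -> : (fun y => (EFin \o (h \_ (rect l))) (x, y)) =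
    (EFin \o (fun s => h (x, s))) \_ `[0, 1].
  rewrite restrict_EFin; apply/funext => s; exact: (congr1 EFin (etrans (rect_restrict h x s) (ifT
    _ _ xl))).
by move=> i; apply/(integrable_mkcond _ _).2.
Qed.

(** The real inner integral is [fine] of the extended one; [fine] sends infinite values to 0, so it
    is dominated by the extended integral, which Fubini makes integrable. *)
Lemma rect_integrable : mu.-integrable `[0, l]
  (EFin \o (fun x => \int[mu]_(s in `[0, 1]) h (x, s))).
Proof.
have := integrable_fubini_F iH; rewrite /fubini_F/=.
under eq_fun do rewrite inner.
move=> j.
have i : mu.-integrable `[0, l] (fun x => \int[mu]_(s in `[0%R, 1%R]) (h (x, s))%:E)%E.
  by apply/(integrable_mkcond _ _).2.
apply: le_integrable (i) => //.
  by apply: measurableT_comp => //; apply: measurableT_comp (measurable_int _ i) => //.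
by move=> x _; rewrite /= /Rintegral; case: integral => [r||] //=; rewrite normr0 leey.
Qed.

Lemma rect_fubini : \int[mu]_(x in `[0, l]) \int[mu]_(s in `[0, 1]) h (x, s) =
  \int[mu2]_(z in rect l) h z.
Proof.
rewrite [RHS]Rintegral_mkcond; congr fine.
apply: (etrans _ (integral12_prod_meas1 iH)); rewrite /fubini_F/=.
under [RHS]eq_integral do rewrite inner.
rewrite -[RHS]integral_mkcond.
apply: ae_eq_integral => //.
- exact: measurable_int rect_integrable.
- apply: measurable_int (_ : mu.-integrable _ _); apply/(integrable_mkcond _ _).2 => //.
  by have := integrable_fubini_F iH; rewrite /fubini_F/=; under eq_fun do rewrite inner.
- apply: ae_mono rect_ae_integrable => x /= hx /hx ix.
  by rewrite fineK//; exact: integrable_fin_num ix.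
Qed.
End RectFubini.

Lemma rect_L2_integrable f : square_integrable mu2 (rect l) f ->
  mu2.-integrable (rect l) (EFin \o f).
Proof.
move=> [mf if2]; apply: (@integrable_bound _ _ _ mu2 _ mrect _ (fun z => 1 + f z ^+ 2)) => //.
  move=> x _; rewrite ler_norml; apply/andP; split.
    by have := sqr_ge0 (f x + 1); rewrite sqrrD; nra.
  by have := sqr_ge0 (f x - 1); rewrite sqrrB; nra.
apply: (L1D mrect) => //.
apply/integrableP; split; first exact: measurable_cst.
rewrite (_ : (fun z => _) = cst 1%E); last by apply/funext => z; rewrite /= normr1.
rewrite (integral_cst _ mrect) mul1e.
have -> : (mu2 (rect l) < +oo)%E = true; last by [].
rewrite /rect product_measure1E//.
have : (mu `[0%R, l]%classic * mu `[0%R, 1%R]%classic < +oo)%E; last exact.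
by rewrite !lebesgue_measure_itv/= !lte_fin l_gt0 ltr01 -!EFinB -EFinM ltry.
Qed.

Lemma is_sderiv_primitive u w : is_sderiv l u w -> {ae mu, forall x, x \in `[0, l] ->
  is_primitive 0 1 (fun s => u (x, s)) (fun s => w (x, s))}.
Proof.
move=> [w2]; apply: ae_mono2 (rect_ae_integrable (rect_L2_integrable w2)) => x iw uw xl.
by split; [exact: iw|exact: uw].
Qed.

Lemma is_sderiv_lin r u w u' w' : is_sderiv l u w -> is_sderiv l u' w' ->
  is_sderiv l (fun z => r * u z + u' z) (fun z => r * w z + w' z).
Proof.
move=> uw u'w'; split; first exact: (L2_lin mrect _ uw.1 u'w'.1).
apply: ae_mono2 (is_sderiv_primitive uw) (is_sderiv_primitive u'w') => x h h' xl s sI.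
by have [_ /(_ s sI)] := is_primitiveD (is_primitiveZ r (h xl)) (h' xl).
Qed.

Lemma trace_measurable (u : R * R -> R) (s : R) :
  measurable_fun (T := (measurableTypeR R * measurableTypeR R)%type) (rect l) u -> s \in `[0, 1] ->
  measurable_fun (T := measurableTypeR R) `[0, l] (fun x => u (x, s)).
Proof.
move=> mu_ sI.
apply: (measurable_comp (f := u) (g := fun x => (x, s)) mrect _ mu_).
- by move=> _ [x xl <-]; split.
- by apply: measurable_funTS; exact: measurable_pair2.
Qed.

Lemma history_weight (z : R * R) : rect l z -> `|2 - z.2| <= 2.
Proof.
move=> [_ /=]; rewrite in_itv/= => /andP[s0 s1].
by rewrite ler_norml; apply/andP; split; lra.
Qed.

Lemma history_weight_measurable :
  measurable_fun (T := (measurableTypeR R * measurableTypeR R)%type) (rect l) (fun z : R * R => 2 -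
    z.2).
Proof.
by apply: measurable_funB => //; apply: measurable_funTS; exact: measurable_snd.
Qed.

(** For almost every x, (2 - s) u(x, s)^2 is integrated in s from its derivative: it equals 2 v^2 at
    s = 0 and u(x, 1)^2 at s = 1. The right-hand side is integrable in x, which is also what puts
    the trace u(., 1) in L^2. *)
Lemma history_trace (u w : R * R -> R) (v : R -> R) : square_integrable mu2 (rect l) u -> is_sderiv
  l u w ->
  square_integrable mu `[0, l] v -> {ae mu, forall x, x \in `[0, l] -> v x = u (x, 0)} ->
  square_integrable mu `[0, l] (fun x => u (x, 1)) /\
  \int[mu]_(x in `[0, l]) u (x, 1) ^+ 2 = 2 * \int[mu]_(x in `[0, l]) v x ^+ 2
    + 2 * wpair mu2 (rect l) (fun z => 2 - z.2) u w - \int[mu2]_(z in rect l) u z ^+ 2.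
Proof.
move=> u2 uw v2 vu.
have m1 : measurable_fun (T := measurableTypeR R) `[0, l] (fun x => u (x, 1)).
  by apply: trace_measurable => //; [exact: u2.1|rewrite in_itv/= ler01 lexx].
pose p z : R := (2 - (z : R * R).2) * (u z * w z).
have ip : mu2.-integrable (rect l) (EFin \o p).
  exact: (wpair_integrable mrect history_weight_measurable history_weight u2 uw.1).
pose h z := 2 * p z - u z ^+ 2.
have ih : mu2.-integrable (rect l) (EFin \o h).
  by apply: (L1B mrect); [exact: (L1Z mrect)|exact: u2.2].
have jh := rect_integrable ih.
have ae1 : ae_eq mu `[0, l]%classic (fun x => 2 * v x ^+ 2 + \int[mu]_(s in `[0, 1]) h (x, s))
    (fun x => u (x, 1) ^+ 2).
  apply: ae_mono2 (is_sderiv_primitive uw) vu => x uP vx xl.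
  have {}uP := uP xl; rewrite (vx xl).
  (* The weight 2 - s, assembled as a primitive with derivative -1. *)
  have q := is_primitiveD (is_primitive_cst (0 : R) 1 2) (is_primitiveZ (-1) (is_primitive_id 0 1)).
  have [_ P] := is_primitiveM ler01 q (is_primitiveM ler01 uP uP).
  have := P 1; rewrite in_itv/= ler01 lexx => /(_ isT).
  rewrite (_ : \int[mu]_(s in `[0, 1]) h (x, s) =
    \int[mu]_(s in `[0, 1]) ((0 + -1 * 1) * (u (x, s) * u (x, s)) +
      (2 + -1 * s) * (w (x, s) * u (x, s) + u (x, s) * w (x, s)))); last first.
    by apply: eq_Rintegral => s _; rewrite /h /p/=; ring.
  by move=> e; lra.
have i1 : mu.-integrable `[0, l] (EFin \o (fun x => 2 * v x ^+ 2 + \int[mu]_(s in `[0, 1]) h (x,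
  s))).
  by apply: L1D => //; apply: L1Z => //; exact: v2.2.
have m12 : measurable_fun (T := measurableTypeR R) `[0, l] (fun x => u (x, 1) ^+ 2).
  exact: measurable_funX.
split; first by split => //; apply: ae_eq_integrable ae1 i1 => //.
rewrite -(ae_eq_Rintegral _ (integrable_measurable i1) m12 ae1)//.
rewrite RintegralD//; [|by apply: L1Z => //; exact: v2.2].
rewrite rect_fubini// RintegralZl//; last exact: v2.2.
rewrite /h (RintegralB mrect)//; [|exact: (L1Z mrect 2 ip)|exact: u2.2].
by rewrite (RintegralZl 2 mrect)// addrA.
Qed.

End History.

(** * The Lyapunov form *)

Section BeamIdentities.
Variables (R : realType) (l T kappa : R).
Hypothesis l_gt0 : 0 < l.
Notation mu := (@lebesgue_measure R).
Notation D := [set` `[0, l]].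
Notation L2 := (square_integrable mu D).

Lemma cst1_bounded d (X : measurableType d) (E : set X) x : E x -> `|cst (1 : R) x| <= 1.
Proof. by rewrite normr1. Qed.

Let mD : measurable (D : set (measurableTypeR R)). Proof. exact: measurable_itv. Qed.

Lemma id_bounded x : D x -> `|x| <= l.
Proof. by rewrite /= in_itv/= => /andP[x0 xl]; rewrite ger0_norm. Qed.

Lemma id_measurable : measurable_fun (T := measurableTypeR R) D (fun x : R => x).
Proof. exact: measurable_id. Qed.

Variables (j i : nat -> R -> R) (y v : R -> R).
Hypotheses (jP : sobolev_jet 0 l 4 y j) (iP : sobolev_jet 0 l 2 v i).
Hypotheses (i00 : i 0%N 0 = 0) (i10 : i 1%N 0 = 0) (j10 : j 1%N 0 = 0).
Hypotheses (j2l : j 2%N l = 0) (j3l : j 3%N l - T * j 1%N l = kappa * i 0%N l).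

Let jL2 k : (k <= 4)%N -> L2 (j k). Proof. by case: jP => _ + _; apply. Qed.
Let iL2 k : (k <= 2)%N -> L2 (i k). Proof. by case: iP => _ + _; apply. Qed.
Let l_in : l \in `[0, l]. Proof. by rewrite in_itv/= lexx ltW. Qed.
Let l_ge0 := ltW l_gt0.
Let jPr k (k4 : (k < 4)%N) := sobolev_jet_is_primitive jP k4.
Let iPr k (k2 : (k < 2)%N) := sobolev_jet_is_primitive iP k2.

Let elastic x := - j 4 x + T * j 2 x.

Lemma elastic_L2 : L2 elastic.
Proof.
(* [L2_lin] always adds a second function; the innermost combination is the zero function, as -y'' +
   y''. *)
have := L2_lin mD (-1) (jL2 (isT : 4 <= 4)%N)
  (L2_lin mD T (jL2 (isT : 2 <= 4)%N) (L2_lin mD (-1) (jL2 (isT : 2 <= 4)%N) (jL2 (isT : 2 <=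
    4)%N))).
by congr (square_integrable _ _ _); apply/funext => x; rewrite /elastic; ring.
Qed.

(* The integrand is the derivative of [- v y''' + v' y'' + T v y']. *)
Lemma beam_energy_identity :
  wpair mu D (cst 1) (i 0%N) elastic + wpair mu D (cst 1) (i 2%N) (j 2%N)
  + T * wpair mu D (cst 1) (i 1%N) (j 1%N) = - kappa * i 0%N l ^+ 2.
Proof.
have F1 := is_primitiveZ (-1) (is_primitiveM l_ge0 (iPr (isT : 0 < 2)%N) (jPr (isT : 3 < 4)%N)).
have F2 := is_primitiveM l_ge0 (iPr (isT : 1 < 2)%N) (jPr (isT : 2 < 4)%N).
have F3 := is_primitiveZ T (is_primitiveM l_ge0 (iPr (isT : 0 < 2)%N) (jPr (isT : 1 < 4)%N)).
have [_ /(_ l l_in)] := is_primitiveD (is_primitiveD F1 F2) F3.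
rewrite /= i00 i10 j2l !(mul0r, mulr0, addr0, add0r).
have m1 : measurable_fun (T := measurableTypeR R) D (cst (1 : R)) by exact: measurable_cst.
have E1 := wpair_integrable mD m1 (@cst1_bounded _ _ _) (iL2 (isT : 0 <= 2)%N) elastic_L2.
have E2 := wpair_integrable mD m1 (@cst1_bounded _ _ _) (iL2 (isT : 2 <= 2)%N) (jL2 (isT : 2 <=
  4)%N).
have E3 := wpair_integrable mD m1 (@cst1_bounded _ _ _) (iL2 (isT : 1 <= 2)%N) (jL2 (isT : 1 <=
  4)%N).
rewrite /wpair -RintegralZl// -RintegralD// -RintegralD//; [|exact: L1D|exact: L1Z].
rewrite (@eq_Rintegral _ _ _ mu D (fun x => cst 1 x * (i 0%N x * elastic x) +
  cst 1 x * (i 2%N x * j 2%N x) + T * (cst 1 x * (i 1%N x * j 1%N x)))); last first.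
  by move=> x _; rewrite /elastic/=; ring.
(* Only the end l contributes, through - v (y''' - T y'), which the feedback condition turns into -
   kappa v(l)^2. *)
move=> <-; rewrite -[j 3%N l](subrK (T * j 1%N l)) j3l; ring.
Qed.

(* Obtained by integrating the derivative of
   [x (v^2 / 2 + T y'^2 / 2 - y' y''' + y''^2 / 2) + y' y'']. *)
Lemma beam_multiplier_identity :
  wpair mu D id (j 1%N) elastic + wpair mu D id (i 1%N) (i 0%N) =
  l * (2^-1 * i 0%N l ^+ 2 - T / 2 * j 1%N l ^+ 2 - kappa * (j 1%N l * i 0%N l))
  - 2^-1 * wpair mu D (cst 1) (i 0%N) (i 0%N) - T / 2 * wpair mu D (cst 1) (j 1%N) (j 1%N)
  - 3 / 2 * wpair mu D (cst 1) (j 2%N) (j 2%N).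
Proof.
have H1 := is_primitiveZ 2^-1 (is_primitiveM l_ge0 (iPr (isT : 0 < 2)%N) (iPr (isT : 0 < 2)%N)).
have H2 := is_primitiveZ (T / 2) (is_primitiveM l_ge0 (jPr (isT : 1 < 4)%N) (jPr (isT : 1 < 4)%N)).
have H3 := is_primitiveZ (-1) (is_primitiveM l_ge0 (jPr (isT : 1 < 4)%N) (jPr (isT : 3 < 4)%N)).
have H4 := is_primitiveZ 2^-1 (is_primitiveM l_ge0 (jPr (isT : 2 < 4)%N) (jPr (isT : 2 < 4)%N)).
have H5 := is_primitiveM l_ge0 (jPr (isT : 1 < 4)%N) (jPr (isT : 2 < 4)%N).
have H6 := is_primitiveM l_ge0 (is_primitive_id 0 l)
  (is_primitiveD (is_primitiveD (is_primitiveD H1 H2) H3) H4).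
have [_ /(_ l l_in)] := is_primitiveD H6 H5.
rewrite /= j10 j2l !(mul0r, mulr0, addr0, add0r).
have m1 : measurable_fun (T := measurableTypeR R) D (cst (1 : R)) by exact: measurable_cst.
have W1 f g := wpair_integrable (mu := mu) (f := f) (g := g) mD m1 (@cst1_bounded _ _ _).
have Wx f g := wpair_integrable (mu := mu) (f := f) (g := g) mD id_measurable id_bounded.
have E1 := Wx _ _ (jL2 (isT : 1 <= 4)%N) elastic_L2.
have E2 := Wx _ _ (iL2 (isT : 1 <= 2)%N) (iL2 (isT : 0 <= 2)%N).
have E3 := W1 _ _ (iL2 (isT : 0 <= 2)%N) (iL2 (isT : 0 <= 2)%N).
have E4 := W1 _ _ (jL2 (isT : 1 <= 4)%N) (jL2 (isT : 1 <= 4)%N).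
have E5 := W1 _ _ (jL2 (isT : 2 <= 4)%N) (jL2 (isT : 2 <= 4)%N).
move=> e; suff : wpair mu D id (j 1%N) elastic + wpair mu D id (i 1%N) (i 0%N)
  + 2^-1 * wpair mu D (cst 1) (i 0%N) (i 0%N) + T / 2 * wpair mu D (cst 1) (j 1%N) (j 1%N)
  + 3 / 2 * wpair mu D (cst 1) (j 2%N) (j 2%N) =
  l * (2^-1 * i 0%N l ^+ 2 - T / 2 * j 1%N l ^+ 2 - kappa * (j 1%N l * i 0%N l)) by lra.
(* The feedback condition read backwards: it restores y'''(l), so that the boundary term becomes the
   end value of the integrated function. *)
have -> : kappa * (j 1%N l * i 0%N l) = j 1%N l * (j 3%N l - T * j 1%N l) by rewrite j3l; ring.
rewrite (_ : l * _ = l * (2^-1 * (i 0%N l * i 0%N l) + T / 2 * (j 1%N l * j 1%N l) +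
  -1 * (j 1%N l * j 3%N l))); last by field.
rewrite e /wpair -!RintegralZl// -!RintegralD//; try by do ?[exact: L1Z|apply: L1D].
by apply: eq_Rintegral => x _; rewrite /elastic/=; field.
Qed.

End BeamIdentities.

(** Here [A], [P1], [P2], [U], [U1] stand for the squared norms of v, y', y'', u, u(., 1); [V] =
    v(l), [J] = y'(l); [M1], [M2] pair u(., 1) with v and with x y'. The coefficient of [U1] closes
    exactly: |alpha| / 2 + eps l |alpha| / 2 <= eps / 24 + eps / 48 = eps / 16. On [A], eps / 2 -
    eps / 8 - eps / 24 = eps / 3 remains, and on T [P1] eps / 4, which explains [c <= eps / 4]. *)
Lemma lyapunov_inequality (R : realType) (l tau kappa T alpha eps c : R)
    (A P1 P2 U U1 V J M1 M2 : R) :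
  0 < l -> 0 < tau -> 0 < T -> 0 < eps -> eps * l <= 2^-1 ->
  eps * (l / 2 + l * kappa ^+ 2 / (2 * T)) <= kappa ->
  `|alpha| <= eps / 12 -> `|alpha| * l <= T / 2 -> 0 < c -> c <= eps / 4 -> c <= (2 * tau)^-1 ->
  0 <= A -> 0 <= P1 -> 0 <= P2 -> 0 <= U -> 0 <= U1 ->
  `|M1| <= 2^-1 * (A + U1) -> `|M2| <= l / 2 * (P1 + U1) ->
  - kappa * V ^+ 2 - alpha * M1 - eps / 16 * (U1 + U - 2 * A)
    + eps * (l * (2^-1 * V ^+ 2 - T / 2 * J ^+ 2 - kappa * (J * V))
             - 2^-1 * A - T / 2 * P1 - 3 / 2 * P2 - alpha * M2)
  <= - c * (A + P2 + T * P1 + eps * tau / 8 * U).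
Proof.
move=> l0 tau0 T0 e0 el ek a12 al c0 ce ct A0 P10 P20 U0 U10 M1b M2b.
have a0 := normr_ge0 alpha.
(* Completing the square removes [J]; the resulting multiple of [V ^+ 2] is what the bound of [eps]
   by [kappa] absorbs. *)
have s1 : - T / 2 * J ^+ 2 - kappa * (J * V) <= kappa ^+ 2 / (2 * T) * V ^+ 2.
  rewrite -subr_ge0 (_ : _ - _ = (T * J + kappa * V) ^+ 2 / (2 * T)); last first.
    by field; rewrite gt_eqF.
  by rewrite divr_ge0 ?sqr_ge0// mulr_ge0// ltW.
have s2 : eps * (l * (2^-1 * V ^+ 2 - T / 2 * J ^+ 2 - kappa * (J * V))) <= kappa * V ^+ 2.
  apply: (@le_trans _ _ (eps * (l / 2 + l * kappa ^+ 2 / (2 * T)) * V ^+ 2)).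
    rewrite -[leRHS]mulrA ler_wpM2l ?(ltW e0)//.
    rewrite (_ : (_ + _) * V ^+ 2 = l * (2^-1 * V ^+ 2 + kappa ^+ 2 / (2 * T) * V ^+ 2)); last
      first.
      by field; rewrite gt_eqF.
    by rewrite ler_wpM2l ?(ltW l0)//; lra.
  by rewrite ler_wpM2r ?sqr_ge0.
have s3 : - (alpha * M1) <= `|alpha| * (2^-1 * (A + U1)).
  by apply: le_trans (ler_norm _) _; rewrite normrN normrM ler_wpM2l.
have s4 : - (alpha * M2) <= `|alpha| * (l / 2 * (P1 + U1)).
  by apply: le_trans (ler_norm _) _; rewrite normrN normrM ler_wpM2l.
have s5 : `|alpha| * A <= eps / 12 * A by rewrite ler_wpM2r.
have s6 : `|alpha| * U1 <= eps / 12 * U1 by rewrite ler_wpM2r.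
have s7 : eps * (`|alpha| * l * P1) <= eps * (T / 2 * P1).
  by rewrite ler_wpM2l ?(ltW e0)// ler_wpM2r.
have s8 : eps * l * (`|alpha| * U1) <= 2^-1 * (`|alpha| * U1).
  by rewrite ler_wpM2r// mulr_ge0.
have s9 : eps * - (alpha * M2) <= eps * (`|alpha| * (l / 2 * (P1 + U1))).
  by rewrite ler_wpM2l ?(ltW e0).
have t1 : c * A <= eps / 4 * A by rewrite ler_wpM2r.
have t2 : c * P2 <= eps / 4 * P2 by rewrite ler_wpM2r.
have t3 : c * (T * P1) <= eps / 4 * (T * P1) by rewrite ler_wpM2r// mulr_ge0// ltW.
have t4 : c * (eps * tau / 8 * U) <= eps / 16 * U.
  apply: (@le_trans _ _ ((2 * tau)^-1 * (eps * tau / 8 * U))).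
    by rewrite ler_wpM2r// mulr_ge0// divr_ge0// mulr_ge0// ltW.
  by rewrite le_eqVlt; apply/orP; left; apply/eqP; field; rewrite gt_eqF.
have t5 : 0 <= eps * P2 by rewrite mulr_ge0// ltW.
have t6 : 0 <= eps * U1 by rewrite mulr_ge0// ltW.
have t7 : 0 <= eps * A by rewrite mulr_ge0// ltW.
lra.
Qed.

Section Lyapunov.
Variables (R : realType) (l T tau eps : R).
Hypotheses (l_gt0 : 0 < l) (T_gt0 : 0 < T) (tau_gt0 : 0 < tau) (eps_gt0 : 0 < eps).
Hypotheses (eps_l : eps * l <= 2^-1) (eps_T : eps * l <= T / 2).
Notation mu := (@lebesgue_measure R).
Notation mu2 := (lebesgue2 R).
Notation D := [set` `[0, l]].
Notation xi := (eps * tau / 8).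
Notation weight := (fun z : R * R => 2 - z.2).

(* The weight [2 - s] decreases from [2] to [1], so that the transport of the history
   also dissipates its interior norm. *)
Definition lyapunov (Y W : state R) : R :=
  wpair mu D (cst 1) (vel Y) (vel W)
  + wpair mu D (cst 1) (pos_deriv l 2 Y) (pos_deriv l 2 W)
  + T * wpair mu D (cst 1) (pos_deriv l 1 Y) (pos_deriv l 1 W)
  + xi * wpair mu2 (rect l) weight (hist Y) (hist W)
  + eps * (wpair mu D id (pos_deriv l 1 Y) (vel W) + wpair mu D id (pos_deriv l 1 W) (vel Y)).

(** Twice the energy of the state, for [xi] = eps tau / 8. *)
Definition sq_energy (Y : state R) : R :=
  \int[mu]_(x in D) vel Y x ^+ 2 + \int[mu]_(x in D) pos_deriv l 2 Y x ^+ 2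
  + T * \int[mu]_(x in D) pos_deriv l 1 Y x ^+ 2 + xi * \int[mu2]_(z in rect l) hist Y z ^+ 2.

Let mD : measurable (D : set (measurableTypeR R)). Proof. exact: measurable_itv. Qed.
Let mR := @measurable_rect R l.
Let m1 : measurable_fun (T := measurableTypeR R) D (cst (1 : R)).
Proof. exact: measurable_cst. Qed.
Let xi_gt0 : 0 < xi. Proof. by rewrite divr_gt0// mulr_gt0. Qed.

Lemma sq_int_ge0 d (X : measurableType d) (m : {measure set X -> \bar R}) E f :
  0 <= \int[m]_(x in E) f x ^+ 2.
Proof. by apply: Rintegral_ge0 => x _; exact: sqr_ge0. Qed.

Lemma lyapunov_sym_bilinear : sym_bilinear (@inH R l) lyapunov.
Proof.
have HL := @inH_lin_closed R l l_gt0.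
have F1 := @pos_deriv_feature R l l_gt0 1 isT.
have F2 := @pos_deriv_feature R l l_gt0 2 isT.
apply: sym_bilinearD; [apply: sym_bilinearD; [apply: sym_bilinearD; [apply: sym_bilinearD|]|]|].
- exact: (sym_bilinear_diag mD m1 (@cst1_bounded _ _ _ _) HL (vel_feature l)).
- exact: (sym_bilinear_diag mD m1 (@cst1_bounded _ _ _ _) HL F2).
- apply: sym_bilinearZ.
  exact: (sym_bilinear_diag mD m1 (@cst1_bounded _ _ _ _) HL F1).
- apply: sym_bilinearZ.
  exact: (sym_bilinear_diag mR (@history_weight_measurable R l) (@history_weight R l) HL
    (hist_feature l)).
- apply: sym_bilinearZ.
  exact: (sym_bilinear_cross mD (@id_measurable R l) (@id_bounded R l) HL F1 (vel_feature l)).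
Qed.

(** The cross term is at most half of |v|^2 + T |y'|^2 by the two bounds on [eps * l], and the
    history weight lies between 1 and 2. *)
Lemma lyapunov_bounds Y : inH l Y ->
  2^-1 * sq_energy Y <= lyapunov Y Y <= 2 * sq_energy Y.
Proof.
move=> HY; have [_ v2 h2] := HY.
have p2 := (@pos_deriv_feature R l l_gt0 1 isT).1 Y HY.
rewrite /lyapunov /sq_energy !wpair1.
have := wpair_le mD (@id_measurable R l) (@id_bounded R l) p2 v2 ltr01 (ltW l_gt0).
rewrite invr1 !mul1r.
set M := wpair mu D id _ _.
set A := \int[mu]_(x in D) vel Y x ^+ 2; set P1 := \int[mu]_(x in D) pos_deriv l 1 Y x ^+ 2.
set P2 := \int[mu]_(x in D) pos_deriv l 2 Y x ^+ 2; set U := \int[mu2]_(z in _) _.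
have [A0 P10 P20 U0] : [/\ 0 <= A, 0 <= P1, 0 <= P2 & 0 <= U] by split; exact: sq_int_ge0.
move=> Mb.
have iW := wpair_integrable mR (@history_weight_measurable R l) (@history_weight R l) h2 h2.
have [W1 W2] : U <= wpair mu2 (rect l) weight (hist Y) (hist Y) /\
    wpair mu2 (rect l) weight (hist Y) (hist Y) <= 2 * U.
  split; last rewrite -(RintegralZl 2 mR)//; try exact: h2.2.
    apply: le_Rintegral => //; first exact: h2.2.
    move=> z [_ /=]; rewrite in_itv/= => /andP[s0 s1]; have := sqr_ge0 (hist Y z); nra.
  apply: le_Rintegral => //; first by apply: (L1Z mR); exact: h2.2.
  by move=> z [_ /=]; rewrite in_itv/= => /andP[s0 s1]; have := sqr_ge0 (hist Y z); nra.
set W := wpair _ _ _ _ _ in W1 W2 *.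
have eM : `|eps * (M + M)| <= eps * l * (P1 + A).
  rewrite normrM gtr0_norm// -mulrA ler_wpM2l ?(ltW eps_gt0)//.
  by apply: le_trans (ler_normD _ _) _; lra.
have e1 : eps * l * P1 <= T / 2 * P1 by rewrite ler_wpM2r.
have e2 : eps * l * A <= 2^-1 * A by rewrite ler_wpM2r.
have w1 : xi * U <= xi * W by rewrite ler_wpM2l// ltW.
have w2 : xi * W <= xi * (2 * U) by rewrite ler_wpM2l// ltW.
have TP : 0 <= T * P1 by rewrite mulr_ge0// ltW.
have xU : 0 <= xi * U by rewrite mulr_ge0// ltW.
move: eM; rewrite ler_norml => /andP[eM1 eM2].
by apply/andP; split; lra.
Qed.

Lemma sq_energy_ge0 Y : 0 <= sq_energy Y.
Proof. by rewrite !addr_ge0 ?mulr_ge0 ?sq_int_ge0// ltW. Qed.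

Lemma lyapunov_psd : psd_form (@inH R l) lyapunov.
Proof.
split; first exact: lyapunov_sym_bilinear.
move=> Y HY; have /andP[+ _] := lyapunov_bounds HY; apply: le_trans.
by rewrite mulr_ge0// sq_energy_ge0.
Qed.

(** A crude constant suffices, since it only serves continuity: each coefficient 1, T, xi is at most
    their sum. *)
Lemma lyapunov_le_dotH Y : inH l Y -> lyapunov Y Y <= 2 * (1 + T + xi) * dotH l Y Y.
Proof.
move=> HY; have /andP[_] := lyapunov_bounds HY; move=> /le_trans; apply.
rewrite -mulrA ler_wpM2l// dotHE !big_ord_recr big_ord0/= add0r !wpair1 /sq_energy.
have := sq_int_ge0 mu D (pos_deriv l 0 Y); have := sq_int_ge0 mu D (pos_deriv l 1 Y).
have := sq_int_ge0 mu D (pos_deriv l 2 Y); have := sq_int_ge0 mu D (vel Y).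
have := sq_int_ge0 mu2 (rect l) (hist Y).
set a := Rintegral _ _ _; set b := Rintegral _ _ _; set c := Rintegral _ _ _.
set e := Rintegral _ _ _; set f := Rintegral _ _ _ => a0 b0 c0 e0 f0.
have /ltW xi0 := xi_gt0; have T0 := ltW T_gt0.
have [Ta Tb Tc Te] := And4 (mulr_ge0 T0 a0) (mulr_ge0 T0 b0) (mulr_ge0 T0 c0) (mulr_ge0 T0 e0).
have [Tf xb xc xe xf] := And5 (mulr_ge0 T0 f0) (mulr_ge0 xi0 b0) (mulr_ge0 xi0 c0) (mulr_ge0 xi0
  e0) (mulr_ge0 xi0 f0).
rewrite !mulrDl !mulrDr !mul1r.
lra.
Qed.

Variables (kappa alpha c : R).
Hypotheses (eps_kappa : eps * (l / 2 + l * kappa ^+ 2 / (2 * T)) <= kappa).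
Hypotheses (alpha_eps : `|alpha| <= eps / 12) (alpha_l : `|alpha| * l <= T / 2).
Hypotheses (c_gt0 : 0 < c) (c_eps : c <= eps / 4) (c_tau : c <= (2 * tau)^-1).

(** [W] plays A Y, up to null sets. The derivatives [j], [i], [w] are parameters because for a
    difference of states they are taken as differences of derivatives, not as the ones chosen by
    [xget]. *)
Lemma lyapunov_dissipation (Y W : state R) (j i : nat -> R -> R) (w : R * R -> R) :
  inH l Y -> inH l W ->
  sobolev_jet 0 l 4 (pos Y) j -> sobolev_jet 0 l 2 (vel Y) i -> is_sderiv l (hist Y) w ->
  {ae mu, forall x, x \in `[0, l] -> vel Y x = hist Y (x, 0)} ->
  i 0%N 0 = 0 -> i 1%N 0 = 0 -> j 1%N 0 = 0 -> j 2%N l = 0 ->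
  j 3%N l - T * j 1%N l = kappa * i 0%N l ->
  (forall x, x \in `[0, l] -> pos W x = vel Y x) ->
  ae_eq mu D (vel W) (fun x => - j 4%N x + T * j 2%N x - alpha * hist Y (x, 1)) ->
  ae_eq mu2 (rect l) (hist W) (fun z => - tau^-1 * w z) ->
  2 * lyapunov Y W <= - c * lyapunov Y Y.
Proof.
move=> HY HW jP iP uw tr i00 i10 j10 j2l j3l pW vW hW.
have [_ vY2 hY2] := HY; have [_ vW2 hW2] := HW.
have jL2 k : (k <= 4)%N -> square_integrable mu D (j k) by case: jP => _ + _; apply.
have iL2 k : (k <= 2)%N -> square_integrable mu D (i k) by case: iP => _ + _; apply.
have aeY k : (k <= 2)%N -> ae_eq mu D (pos_deriv l k Y) (j k).
  move=> k2; have J := sobolev_jet_leq (isT : 2 <= 4)%N jP.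
  exact: sobolev_jet_ae_unique l_gt0 (sobolev_derivP (ex_intro _ _ J)) J k k2.
have aeW k : (k <= 2)%N -> ae_eq mu D (pos_deriv l k W) (i k).
  move=> k2; have J : sobolev_jet 0 l 2 (pos W) i.
    by apply: sobolev_jet_eq iP => x xl; rewrite pW.
  exact: sobolev_jet_ae_unique l_gt0 (sobolev_derivP (ex_intro _ _ J)) J k k2.
have aev : ae_eq mu D (vel Y) (i 0%N).
  by apply: ae_eqW => x xl; case: iP => ->.
have PL2 Z k : inH l Z -> (k <= 2)%N -> square_integrable mu D (pos_deriv l k Z).
  by move=> HZ k2; exact: (@pos_deriv_feature R l l_gt0 k k2).1.
have [u12 U1E] := history_trace l_gt0 hY2 uw vY2 tr.
have el2 := elastic_L2 T jP.
set u1 := (fun x => hist Y (x, 1)) in u12 U1E vW *.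
set el := (fun x => - j 4%N x + T * j 2%N x) in el2.
have g2 : square_integrable mu D (fun x => - alpha * u1 x + el x) by exact: L2_lin.
have vWg : ae_eq mu D (vel W) (fun x => - alpha * u1 x + el x).
  by apply: ae_mono vW => x + xl => -> //; rewrite /el /u1; ring.
have b1 := @cst1_bounded R _ (measurableTypeR R) D.
have c1 := wpair_ae_eq mD m1 b1 vY2 (iL2 0%N isT) vW2 g2 aev vWg.
have c2 := wpair_ae_eq mD m1 b1 (PL2 Y 2%N HY isT) (jL2 2%N isT) (PL2 W 2%N HW isT) (iL2 2%N isT)
  (aeY 2%N isT) (aeW 2%N isT).
have c3 := wpair_ae_eq mD m1 b1 (PL2 Y 1%N HY isT) (jL2 1%N isT) (PL2 W 1%N HW isT) (iL2 1%N isT)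
  (aeY 1%N isT) (aeW 1%N isT).
have c4 := wpair_ae_eq mD (@id_measurable R l) (@id_bounded R l) (PL2 Y 1%N HY isT) (jL2 1%N isT)
  vW2 g2
  (aeY 1%N isT) vWg.
have c5 := wpair_ae_eq mD (@id_measurable R l) (@id_bounded R l) (PL2 W 1%N HW isT) (iL2 1%N isT)
  vY2 (iL2 0%N isT)
  (aeW 1%N isT) aev.
have h2' : square_integrable mu2 (rect l) (fun z => - tau^-1 * w z).
  (* A multiple of [w] in the shape of [L2_lin]: (- tau^-1 - 1) w + w. *)
  have := L2_lin mR (- tau^-1 - 1) uw.1 uw.1.
  by congr (square_integrable _ _ _); apply/funext => z; ring.
have c6 := wpair_ae_eq mR (@history_weight_measurable R l) (@history_weight R l) hY2 hY2 hW2 h2'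
  (@ae_eqW _ _ R mu2 _ _ _ (fun z _ => erefl (hist Y z))) hW.
have c6' : wpair mu2 (rect l) weight (hist Y) (fun z => - tau^-1 * w z) =
    - tau^-1 * wpair mu2 (rect l) weight (hist Y) w.
  rewrite /wpair -(RintegralZl _ mR); last first.
    exact: (wpair_integrable mR (@history_weight_measurable R l) (@history_weight R l) hY2 uw.1).
  by apply: eq_Rintegral => z _; ring.
have d1 : wpair mu D (cst 1) (i 0%N) (fun x => - alpha * u1 x + el x) =
    - alpha * wpair mu D (cst 1) (i 0%N) u1 + wpair mu D (cst 1) (i 0%N) el.
  rewrite wpairC (wpair_lin mD m1 b1 _ u12 el2 (iL2 0%N isT)).
  by rewrite wpairC [X in _ + X]wpairC.
have d4 : wpair mu D id (j 1%N) (fun x => - alpha * u1 x + el x) =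
    - alpha * wpair mu D id (j 1%N) u1 + wpair mu D id (j 1%N) el.
  rewrite wpairC (wpair_lin mD (@id_measurable R l) (@id_bounded R l) _ u12 el2 (jL2 1%N isT)).
  by rewrite wpairC [X in _ + X]wpairC.
have I1 := beam_energy_identity l_gt0 jP iP i00 i10 j2l j3l.
have I2 := beam_multiplier_identity l_gt0 jP iP j10 j2l j3l.
have M1b := wpair_le mD m1 b1 (iL2 0%N isT) u12 ltr01 ler01.
have M2b := wpair_le mD (@id_measurable R l) (@id_bounded R l) (jL2 1%N isT) u12 ltr01 (ltW l_gt0).
rewrite invr1 !mul1r in M1b M2b.
have eA : \int[mu]_(x in D) vel Y x ^+ 2 = \int[mu]_(x in D) i 0%N x ^+ 2.
  rewrite -!wpair1; exact: (wpair_ae_eq mD m1 b1 vY2 (iL2 0%N isT) vY2 (iL2 0%N isT) aev aev).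
have eP k (k2 : (k <= 2)%N) : \int[mu]_(x in D) pos_deriv l k Y x ^+ 2 = \int[mu]_(x in D) j k x ^+
  2.
  have k4 : (k <= 4)%N by exact: leq_trans k2 _.
  rewrite -!wpair1; exact: (wpair_ae_eq mD m1 b1 (PL2 _ _ HY k2) (jL2 k k4) (PL2 _ _ HY k2) (jL2 k
    k4) (aeY k k2) (aeY k k2)).
have /andP[_ LY] := lyapunov_bounds HY.
have key := lyapunov_inequality (i 0%N l) (j 1%N l) l_gt0 tau_gt0 T_gt0 eps_gt0 eps_l eps_kappa
  alpha_eps alpha_l c_gt0 c_eps c_tau (sq_int_ge0 mu D (i 0%N)) (sq_int_ge0 mu D (j 1%N))
  (sq_int_ge0 mu D (j 2%N)) (sq_int_ge0 mu2 (rect l) (hist Y)) (sq_int_ge0 mu D u1) M1b M2b.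
(* The factor 2 in the goal then compensates the factor 2 in the bound of [lyapunov Y Y] by
   [sq_energy Y]. *)
have LYW : lyapunov Y W <= - c * sq_energy Y.
  rewrite /sq_energy eA (eP 1%N isT) (eP 2%N isT).
  apply: le_trans key; rewrite /lyapunov c1 c2 c3 c4 c5 c6 c6' d1 d4.
  rewrite le_eqVlt; apply/orP; left; apply/eqP.
  have := wpairC mu D (cst 1) (i 2%N) (j 2%N).
  have := wpairC mu D (cst 1) (i 1%N) (j 1%N).
  move=> C1 C2; rewrite -C1 -C2.
  rewrite -(addrA (- alpha * wpair mu D id (j 1%N) u1)) I2.
  rewrite -2!(addrA (- alpha * wpair mu D (cst 1) (i 0%N) u1)) I1 U1E eA !wpair1.
  by field; rewrite gt_eqF.
apply: (@le_trans _ _ (2 * (- c * sq_energy Y))); first by rewrite ler_pM2l.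
have : c * lyapunov Y Y <= c * (2 * sq_energy Y) by rewrite ler_pM2l.
lra.
Qed.

End Lyapunov.

(** * Dissipation along mild solutions and transfer to the energy *)

Section MildSolutions.
Variables (R : realType) (l T tau eps kappa alpha c : R).
Hypotheses (l_gt0 : 0 < l) (T_gt0 : 0 < T) (tau_gt0 : 0 < tau) (eps_gt0 : 0 < eps).
Hypotheses (eps_l : eps * l <= 2^-1) (eps_T : eps * l <= T / 2).
Hypotheses (eps_kappa : eps * (l / 2 + l * kappa ^+ 2 / (2 * T)) <= kappa).
Hypotheses (alpha_eps : `|alpha| <= eps / 12) (alpha_l : `|alpha| * l <= T / 2).
Hypotheses (c_gt0 : 0 < c) (c_eps : c <= eps / 4) (c_tau : c <= (2 * tau)^-1).
Notation mu := (@lebesgue_measure R).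
Notation mu2 := (lebesgue2 R).
Notation D := [set` `[0, l]].

Lemma is_sderivP (u : R * R -> R) : L2H1 l u -> is_sderiv l u (sderiv l u).
Proof.
move=> [_ [w uw]].
exact: (@xgetPex _ (fun _ => 0) [set w | is_sderiv l u w] (ex_intro _ w uw)).
Qed.

(** The common term [Y0] cancels in [W2 - W1], leaving A applied to [Z2 - Z1]. All conditions
    defining D(A) are linear, so they pass to the difference. *)
Lemma domA_dissipation (Y0 Z1 Z2 W1 W2 : state R) : domA l T kappa Z1 -> domA l T kappa Z2 ->
  inH l W1 -> inH l W2 ->
  eqH l W1 (Y0 + opA l tau T alpha Z1) -> eqH l W2 (Y0 + opA l tau T alpha Z2) ->
  2 * lyapunov l T tau eps (Z2 - Z1) (W2 - W1) <=
  - c * lyapunov l T tau eps (Z2 - Z1) (Z2 - Z1).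
Proof.
move=> [HZ1 /sobolev_derivP y1 V1 /is_sderivP w1 [tr1 j21 j31]].
move=> [HZ2 /sobolev_derivP y2 V2 /is_sderivP w2 [tr2 j22 j32]] HW1 HW2.
move=> [p1 q1 r1] [p2 q2 r2].
have HL := @inH_lin_closed R l l_gt0.
have -> : Z2 - Z1 = -1 *: Z1 + Z2 by rewrite scaleN1r addrC.
have -> : W2 - W1 = -1 *: W1 + W2 by rewrite scaleN1r addrC.
have [v1 [v10 v1'0]] := V1; have [v2 [v20 v2'0]] := V2.
have o0 : 0 \in `[0, l] by rewrite in_itv/= lexx ltW.
have ol : l \in `[0, l] by rewrite in_itv/= lexx ltW.
have J : sobolev_jet 0 l 4 (pos (-1 *: Z1 + Z2)) _ := sobolev_jet_lin (-1) y1 y2.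
have I : sobolev_jet 0 l 2 (vel (-1 *: Z1 + Z2)) _ :=
  sobolev_jet_lin (-1) (sobolev_derivP v1) (sobolev_derivP v2).
have w12 : is_sderiv l (hist (-1 *: Z1 + Z2)) _ := is_sderiv_lin l_gt0 (-1) w1 w2.
(* The clamped condition speaks of the derivative chosen in H^2, the dissipation of the one chosen
   in H^4; uniqueness below the top order identifies them at 0. *)
have j10 Z : inH l Z -> sobolev_jet 0 l 4 (pos Z) (sobolev_deriv 0 l 4 (pos Z)) ->
    sobolev_deriv 0 l 4 (pos Z) 1 0 = 0.
  move=> [[_ [_ e]] _ _] ZJ; rewrite -[RHS]e.
  have ZJ2 := sobolev_jet_leq (isT : 2 <= 4)%N ZJ.
  exact: sobolev_jet_unique l_gt0 ZJ2 (sobolev_derivP (ex_intro _ _ ZJ2)) 1%N isT _ o0.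
have i0 Z : H2E l (vel Z) -> forall x, x \in `[0, l] -> sobolev_deriv 0 l 2 (vel Z) 0 x = vel Z x.
  by move=> [/sobolev_derivP[+ _ _] _] x; apply.
apply: (lyapunov_dissipation l_gt0 T_gt0 tau_gt0 eps_gt0 eps_l eps_T eps_kappa alpha_eps alpha_l
  c_gt0 c_eps c_tau (HL _ _ _ HZ1 HZ2) (HL _ _ _ HW1 HW2) J I w12).
- apply: ae_mono2 tr1 tr2 => x h1 h2 xl.
  by rewrite -[LHS]/(-1 * vel Z1 x + vel Z2 x) h1// h2.
- by rewrite !i0// v10 v20; ring.
- by rewrite v1'0 v2'0; ring.
- by rewrite !j10//; ring.
- by rewrite j21 j22; ring.
- rewrite !i0//; move: j31 j32; lra.
- move=> x xl; rewrite -[LHS]/(-1 * pos W1 x + pos W2 x) p1// p2//.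
  rewrite -[RHS]/(-1 * vel Z1 x + vel Z2 x).
  rewrite -[pos (Y0 + _) x]/(pos Y0 x + vel Z1 x) -[pos (Y0 + opA _ _ _ _ Z2) x]/(pos Y0 x + vel Z2
    x).
  by ring.
- apply: ae_mono2 q1 q2 => x h1 h2 xl.
  rewrite -[LHS]/(-1 * vel W1 x + vel W2 x) h1// h2//.
  rewrite -[hist _ (x, 1)]/(-1 * hist Z1 (x, 1) + hist Z2 (x, 1)).
  rewrite -[vel (Y0 + opA _ _ _ _ Z1) x]/(vel Y0 x + (- sobolev_deriv 0 l 4 (pos Z1) 4 x
    + T * sobolev_deriv 0 l 4 (pos Z1) 2 x - alpha * hist Z1 (x, 1))).
  rewrite -[vel (Y0 + opA _ _ _ _ Z2) x]/(vel Y0 x + (- sobolev_deriv 0 l 4 (pos Z2) 4 x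
    + T * sobolev_deriv 0 l 4 (pos Z2) 2 x - alpha * hist Z2 (x, 1))).
  by ring.
- apply: ae_mono2 r1 r2 => z h1 h2 zl.
  rewrite -[LHS]/(-1 * hist W1 z + hist W2 z) h1// h2//.
  rewrite -[hist (Y0 + opA _ _ _ _ Z1) z]/(hist Y0 z + (- tau^-1 * sderiv l (hist Z1) z)).
  rewrite -[hist (Y0 + opA _ _ _ _ Z2) z]/(hist Y0 z + (- tau^-1 * sderiv l (hist Z2) z)).
  by ring.
Qed.

Lemma energyE (Y : R -> state R) t :
  energy l T (eps * tau / 8) Y t = 2^-1 * sq_energy l T tau eps (Y t).
Proof.
by rewrite /energy /sq_energy /pos_deriv; field.
Qed.

Lemma mild_solution_decay Y0 (Y : R -> state R) : mild_solution l tau kappa T alpha Y0 Y ->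
  forall t, 0 <= t ->
  energy l T (eps * tau / 8) Y t <= 4 * energy l T (eps * tau / 8) Y 0 * expR (- c * t).
Proof.
move=> [[HY cY] sol] t t0.
have /choice[Z ZP] : forall s : R, exists Z, 0 <= s ->
    [/\ is_integralH l s Y Z, domA l T kappa Z & eqH l (Y s) (Y0 + opA l tau T alpha Z)].
  (* Choice needs a total function, so [Z] gets the dummy value 0 at negative times. *)
  move=> s; have [s0|s0] := leP 0 s; last by exists 0.
  by have [Z ?] := sol s s0; exists Z.
have HL := @inH_lin_closed R l l_gt0.
have K0 : 0 < 2 * (1 + T + eps * tau / 8).
  by rewrite mulr_gt0// !addr_gt0// ?divr_gt0// mulr_gt0.
have LY := seminorm_decay (Y := Y) (Z := Z) HL (dotH_psd l_gt0) HY cY.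
have := LY _ _ (lyapunov l T tau eps) (Num.sqrt (2 * (1 + T + eps * tau / 8))) c
  (lyapunov_psd l_gt0 T_gt0 tau_gt0 eps_gt0 eps_l eps_T) _ c_gt0 _ _ t t0.
have bnd s : 0 <= s -> _ := fun s0 => lyapunov_bounds l_gt0 T_gt0 tau_gt0 eps_gt0 eps_l eps_T (HY s
  s0).
move=> dec; rewrite !energyE.
have /andP[b1 _] := bnd t t0; have /andP[_ b2] := bnd 0 (lexx 0).
apply: (le_trans b1); apply: le_trans (dec _ _ _ _ _) _.
- by move=> s s0; have [[]] := ZP s s0.
- by move=> s s0 W HW; have [[_ h] _ _] := ZP s s0; exact: h.
- by rewrite sqrtr_gt0.
- by move=> x Hx; rewrite sqr_sqrtr ?(ltW K0)//; exact: lyapunov_le_dotH.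
- move=> a b a0 b0; have [_ da ea] := ZP a a0; have [_ db eb] := ZP b b0.
  exact: domA_dissipation da db (HY a a0) (HY b b0) ea eb.
- by rewrite ler_wpM2r ?expR_ge0//; lra.
Qed.

End MildSolutions.

Theorem theorem2 (R : realType) (l tau kappa T : R)
    (l_gt0 : 0 < l) (tau_gt0 : 0 < tau) (kappa_gt0 : 0 < kappa)
    (T_gt0 : 0 < T) (T_lt : T < 3 / l ^+ 2) :
  exists alpha0 : R, 0 < alpha0 /\
  forall alpha : R, `|alpha| < alpha0 ->
  exists xi : R, 0 < xi /\
  exists zeta1 zeta2 : R, 0 < zeta1 /\ 0 < zeta2 /\
  forall (y0 y1 : R -> R) (f0 : R -> R -> R) (Y : R -> state R),
    beam_solution l tau kappa T alpha y0 y1 f0 Y ->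
    forall t : R, 0 <= t ->
      energy l T xi Y t <= zeta1 * energy l T xi Y 0 * expR (- zeta2 * t).
Proof.
pose q := l / 2 + l * kappa ^+ 2 / (2 * T).
have q0 : 0 < q.
  by rewrite ltr_wpDr ?divr_gt0// divr_ge0 ?mulr_ge0 ?sqr_ge0// ltW.
(* The first two entries make the Lyapunov form equivalent to the energy; the third lets the
   boundary damping absorb the boundary terms of the multiplier. *)
pose eps := Num.min (Num.min (2^-1 / l) (T / 2 / l)) (kappa / q).
have eps0 : 0 < eps by rewrite !lt_min !divr_gt0.
have [e1 e2 e3] : [/\ eps * l <= 2^-1, eps * l <= T / 2 & eps * q <= kappa].
  by split; rewrite -ler_pdivlMr// /eps !ge_min lexx ?orbT.
exists (Num.min (eps / 12) (T / 2 / l)); split; first by rewrite lt_min !divr_gt0.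
move=> alpha; rewrite lt_min => /andP[/ltW a1 /ltW a2].
have a3 : `|alpha| * l <= T / 2 by rewrite -ler_pdivlMr.
exists (eps * tau / 8); split; first by rewrite divr_gt0// mulr_gt0.
(* The rate is limited by the multiplier and by the dissipation of the weighted history. *)
pose c := Num.min (eps / 4) (2 * tau)^-1.
have c0 : 0 < c by rewrite lt_min divr_gt0// invr_gt0 mulr_gt0.
exists 4, c; split=> //; split=> // y0 y1 f0 Y [_ sol] t t0.
have c1 : c <= eps / 4 by rewrite /c ge_min lexx.
have c2 : c <= (2 * tau)^-1 by rewrite /c ge_min lexx orbT.
exact: mild_solution_decay sol t t0.
Qed.
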